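(* Let $F_n$ be a free group with finite basis $X$ and let $\mathbb{A}$ be a finitely generated abelian group. There exists an algorithm that, given finite subsets $\mathcal{S}_1,\mathcal{S}_2\subseteq F_n\times\mathbb{A}$, recursively constructs a Stallings automaton for the intersection $\langle\mathcal{S}_1\rangle\cap\langle\mathcal{S}_2\rangle$ (which need not be finitely generated).
   Context: Elements of $F_n\times\mathbb{A}$ are written $w\,t^{\mathbf a}$ ($w\in F_n$, $\mathbf a\in\mathbb{A}$, $\mathbb{A}$ additive). An (involutive, pointed) $X$-automaton is a directed multigraph with arcs labeled in $X^{\pm}=X\sqcup X^{-1}$ and a basepoint, each arc $p\to q$ labeled $x$ having a unique inverse arc $q\to p$ labeled $x^{-1}$; positive arcs are those with label in $X$. It is deterministic if no two arcs with the same label depart from (or arrive at) the same vertex; core if every vertex lies on a closed walk at the basepoint without backtracking; reduced if deterministic and core. An $\mathbb{A}$-enriched $X$-automaton $\Gamma$ is an involutive pointed digraph with arcs labeled by triples $(\mathbf a,x,\mathbf b)\in\mathbb{A}\times X^{\pm}\times\mathbb{A}$, each arc labeled $(\mathbf a,x,\mathbf b)$ having a unique inverse arc labeled $(\mathbf b,x^{-1},\mathbf a)$, together with a subgroup $L_\Gamma\leqslant\mathbb{A}$ attached to the basepoint. An arc labeled $(\mathbf a,x,\mathbf b)$ reads $x\,t^{\mathbf b-\mathbf a}$, a walk reads the product of its arcs, and at the basepoint any $t^{\mathbf l}$, $\mathbf l\in L_\Gamma$, may be read; the subgroup recognized by $\Gamma$ is the set of elements of $F_n\times\mathbb{A}$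 read by closed walks at the basepoint. The skeleton is the $X$-automaton obtained by forgetting all abelian information; $\Gamma$ is reduced if its skeleton is. For a spanning tree $T$, $\Gamma$ is $T$-normalized if it is reduced, every positive arc has first abelian label $\mathbf 0$, and every positive arc in $T$ has second abelian label $\mathbf 0$. A Stallings automaton for $\mathcal{H}\leqslant F_n\times\mathbb{A}$ is any enriched automaton that recognizes $\mathcal{H}$ and is $T$-normalized for some spanning tree $T$. ''Recursively constructs $\Gamma$'' means: the algorithm computes a finite generating set of the basepoint subgroup $L_\Gamma$ and successively outputs an increasing sequence $\Gamma_0\subseteq\Gamma_1\subseteq\Gamma_2\subseteq\cdots$ of finite subautomata of $\Gamma$ (containing the basepoint) whose union (direct limit) is $\Gamma$. *)

(* Defs.v *)
From Stdlib Require List.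
From HB Require Import structures.
From mathcomp Require Import all_boot all_order all_algebra.
From mathcomp Require Import boolp classical_sets cardinality.

Set Implicit Arguments.
Unset Strict Implicit.
Unset Printing Implicit Defensive.

Import GRing.Theory.
Local Open Scope classical_set_scope.

(* Words over the alphabet $X^{\pm}$ of a finite type X: the letter (x, false) *)
(* stands for x and (x, true) for x^-1.                                       *)
Notation letter X := (X * bool)%type.

Definition linv (X : finType) (a : letter X) : letter X := (a.1, ~~ a.2).
Definition positive (X : finType) (a : letter X) : bool := ~~ a.2.

Notation word X := (seq (letter X)).

Definition reduced_word (X : finType) (w : word X) : bool :=
  sorted (fun a b => b != linv a) w.

Definition push (X : finType) (a : letter X) (w : word X) : word X :=
  if w is b :: w' then if b == linv a then w' else a :: w else [:: a].

Definition reduce (X : finType) (w : word X) : word X := foldr (@push X) [::] w.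

Definition inv_word (X : finType) (w : word X) : word X := rev (map (@linv X) w).

Section Reduction.
Variable X : finType.
Implicit Types (a : letter X) (u v w : word X).

Lemma linvK : involutive (@linv X).
Proof. by case=> x b; rewrite /linv /= negbK. Qed.

Lemma reduced_cons a w : reduced_word (a :: w) -> reduced_word w.
Proof. by case: w => //= b w /andP[]. Qed.

Lemma reduced_push a w : reduced_word w -> reduced_word (push a w).
Proof.
case: w => //= b w rw; case: eqP => [_|/eqP ba]; first exact: (@reduced_cons b).
by rewrite /= ba.
Qed.

Lemma reduced_reduce w : reduced_word (reduce w).
Proof. by elim: w => //= a w IHw; apply: reduced_push. Qed.

Lemma reduce_id w : reduced_word w -> reduce w = w.
Proof.
elim: w => //= a w IHw raw; rewrite IHw ?(reduced_cons raw) //.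
by case: w raw {IHw} => //= b w /andP[/negPf -> _].
Qed.

Lemma push_linv a w : reduced_word w -> push a (push (linv a) w) = w.
Proof.
case: w => [|b w] /=; first by rewrite eqxx.
rewrite linvK; case: eqP => [-> | _ _] /=; last by rewrite eqxx.
by case: w => //= c w /andP[/negPf -> _].
Qed.

Lemma foldr_push_reduce u v :
  reduced_word v -> foldr (@push X) v (reduce u) = foldr (@push X) v u.
Proof.
move=> rv; have rf s : reduced_word (foldr (@push X) v s).
  by elim: s => //= a s; apply: reduced_push.
have fp a s : foldr (@push X) v (push a s) = push a (foldr (@push X) v s).
  by case: s => //= b s; case: eqP => //= ->; rewrite push_linv.
by elim: u => //= a u IHu; rewrite fp IHu.
Qed.

Lemma reduce_cat u v : reduce (u ++ v) = foldr (@push X) (reduce v) u.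
Proof. by rewrite /reduce foldr_cat. Qed.

Lemma reduce_catl u v : reduce (reduce u ++ v) = reduce (u ++ v).
Proof. by rewrite !reduce_cat foldr_push_reduce ?reduced_reduce. Qed.

Lemma reduce_catr u v : reduce (u ++ reduce v) = reduce (u ++ v).
Proof. by rewrite !reduce_cat reduce_id ?reduced_reduce. Qed.

Lemma inv_wordK : involutive (@inv_word X).
Proof. by move=> w; rewrite /inv_word map_rev revK mapK //; apply: linvK. Qed.

Lemma reduce_mul_inv w : reduce (w ++ inv_word w) = [::].
Proof.
elim: w => //= a w; rewrite /inv_word /= rev_cons -cats1 catA.
set s := w ++ _ => IHw; rewrite -reduce_catl IHw /=.
by rewrite eqxx.
Qed.

End Reduction.

Record freegroup (X : finType) :=
  FreeGroup { fgval :> word X; _ : reduced_word fgval }.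
HB.instance Definition _ (X : finType) := [isSub for @fgval X].
HB.instance Definition _ (X : finType) := [Choice of freegroup X by <:].

Definition fg_of_word (X : finType) (w : word X) : freegroup X :=
  FreeGroup (reduced_reduce w).

Section FreeGroup.
Variable X : finType.
Implicit Types u v w : freegroup X.

Definition fg_one : freegroup X := fg_of_word [::].
Definition fg_inv u : freegroup X := fg_of_word (inv_word u).
Definition fg_mul u v : freegroup X := fg_of_word (u ++ v).

Lemma fg_mulA : associative fg_mul.
Proof.
by move=> u v w; apply: val_inj; rewrite /= reduce_catl reduce_catr catA.
Qed.
Lemma fg_mul1 : left_id fg_one fg_mul.
Proof. by move=> [u ru]; apply: val_inj; rewrite /= reduce_id. Qed.
Lemma fg_mulr1 : right_id fg_one fg_mul.
Proof. by move=> [u ru]; apply: val_inj; rewrite /= cats0 reduce_id. Qed.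
Lemma fg_mulrV : right_inverse fg_one fg_inv fg_mul.
Proof.
by move=> u; apply: val_inj; rewrite /= reduce_catr reduce_mul_inv.
Qed.
Lemma fg_mulV : left_inverse fg_one fg_inv fg_mul.
Proof.
move=> u; apply: val_inj; rewrite /= reduce_catl.
by rewrite -{2}[fgval u]inv_wordK reduce_mul_inv.
Qed.
HB.instance Definition _ :=
  isGroup.Build (freegroup X) fg_mulA fg_mul1 fg_mulr1 fg_mulV fg_mulrV.
End FreeGroup.

(* The additive group A in multiplicative notation: the element a of A,       *)
(* viewed in [texp A], is t^a.                                                *)
Definition texp (A : zmodType) : Type := A.
HB.instance Definition _ (A : zmodType) := Choice.on (texp A).
HB.instance Definition _ (A : zmodType) :=
  isGroup.Build (texp A) (@addrA A) (@add0r A) (@addr0 A) (@addNr A) (@addrN A).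

(* The direct product of the free group on X and A; (w, a) stands for w t^a.  *)
Notation FxA X A := (freegroup X * texp A)%type.

Definition is_subgroup (G : groupType) (H : set G) : Prop :=
  H 1%g /\ forall x y, H x -> H y -> H (x / y)%g.

Definition generated (G : groupType) (S : set G) : set G :=
  smallest (@is_subgroup G) S.

Record automaton (X : finType) := Automaton {
  vertex : Type;
  arc : Type;
  source : arc -> vertex;
  target : arc -> vertex;
  label : arc -> letter X;
  arc_inv : arc -> arc;
  base : vertex;
  arc_invK : involutive arc_inv;
  source_inv : forall e, source (arc_inv e) = target e;
  label_inv : forall e, label (arc_inv e) = linv (label e)
}.

Section Automata.
Variables (X : finType) (D : automaton X).
Implicit Types (p q : vertex D) (e : arc D) (s : seq (arc D)).

Fixpoint is_walk p s q : Prop :=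
  if s is e :: s' then source e = p /\ is_walk (target e) s' q else p = q.

Definition no_backtracking s : Prop :=
  forall s1 e s2, s <> s1 ++ e :: arc_inv e :: s2.

Definition deterministic : Prop :=
  forall e f, label e = label f ->
    source e = source f \/ target e = target f -> e = f.

Definition core : Prop :=
  forall p, exists s1 s2,
    [/\ is_walk (base D) s1 p, is_walk p s2 (base D)
      & no_backtracking (s1 ++ s2)].

Definition reduced : Prop := deterministic /\ core.

Definition walk_in (T : set (arc D)) s : Prop := List.Forall T s.

(* A subtree with all the vertices is given by its set of arcs. *)
Definition spanning_tree (T : set (arc D)) : Prop :=
  [/\ forall e, T e -> T (arc_inv e),
      forall p q, exists2 s, walk_in T s & is_walk p s q
    & forall p s, walk_in T s -> is_walk p s p -> no_backtracking s ->
        s = [::]].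

Definition subautomaton (VS : set (vertex D)) (ES : set (arc D)) : Prop :=
  [/\ VS (base D), forall e, ES e -> VS (source e) /\ VS (target e)
    & forall e, ES e -> ES (arc_inv e)].

End Automata.

(* The arc e of an enriched automaton carries the triple                      *)
(* (abel1 e, label e, abel2 e).                                               *)
Record enriched (X : finType) (A : zmodType) := Enriched {
  skeleton :> automaton X;
  abel1 : arc skeleton -> A;
  abel2 : arc skeleton -> A;
  base_group : set A;
  abel1_inv : forall e, abel1 (arc_inv e) = abel2 e;
  base_groupP : is_subgroup (base_group : set (texp A))
}.

Section Enriched.
Variables (X : finType) (A : zmodType) (G : enriched X A).

Definition arc_reading (e : arc G) : FxA X A :=
  (fg_of_word [:: label e], (abel2 e - abel1 e)%R).

(* reads p g q: some walk from p to q reads g, where any t^l with l in L may  *)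
(* be read at each visit of the basepoint.                                    *)
Inductive reads : vertex G -> FxA X A -> vertex G -> Prop :=
| reads_nil p : reads p 1%g p
| reads_arc e g q :
    reads (target e) g q -> reads (source e) (arc_reading e * g)%g q
| reads_abel (l : A) g q :
    base_group G l -> reads (base G) g q ->
    reads (base G) (((1%g, l) : FxA X A) * g)%g q.

Definition recognized : set (FxA X A) := [set g | reads (base G) g (base G)].

Definition normalized (T : set (arc G)) : Prop :=
  [/\ reduced G,
      forall e : arc G, positive (label e) -> abel1 e = 0%R
    & forall e, T e -> positive (label e) -> abel2 e = 0%R].

Definition stallings (H : set (FxA X A)) : Prop :=
  recognized = H /\
  exists2 T : set (arc G), spanning_tree T & normalized T.

End Enriched.

(* Model of computation: a variant of N. D. Jones's WHILE language, whose     *)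
(* data are binary trees. A program maps the current tree to a new one, and   *)
(* Leaf plays the role of "false" in tests. The language is Turing-complete.  *)
Inductive tree : Set := Leaf | Node of tree & tree.

Fixpoint eq_tree (t u : tree) : bool :=
  match t, u with
  | Leaf, Leaf => true
  | Node t1 t2, Node u1 u2 => eq_tree t1 u1 && eq_tree t2 u2
  | _, _ => false
  end.
Lemma eq_treeP : Equality.axiom eq_tree.
Proof.
move=> t u; apply: (iffP idP) => [|<-]; last first.
  by elim: t => //= t1 -> t2 ->.
by elim: t u => [|t1 IH1 t2 IH2] [|u1 u2] //= /andP[/IH1-> /IH2->].
Qed.
HB.instance Definition _ := hasDecEq.Build tree eq_treeP.

Inductive prog : Set :=
| PSkip
| PLeaf
| PHead
| PTail
| PNode of prog & prog
| PSeq of prog & prog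
| PIf of prog & prog & prog
| PWhile of prog & prog.

Definition head_tree (t : tree) : tree := if t is Node u _ then u else Leaf.
Definition tail_tree (t : tree) : tree := if t is Node _ v then v else Leaf.

(* runs P t u: the program P halts on the input t, with output u *)
Inductive runs : prog -> tree -> tree -> Prop :=
| run_skip t : runs PSkip t t
| run_leaf t : runs PLeaf t Leaf
| run_head t : runs PHead t (head_tree t)
| run_tail t : runs PTail t (tail_tree t)
| run_node P Q t u v : runs P t u -> runs Q t v -> runs (PNode P Q) t (Node u v)
| run_seq P Q t u v : runs P t u -> runs Q u v -> runs (PSeq P Q) t v
| run_if_true C P Q t u1 u2 v :
    runs C t (Node u1 u2) -> runs P t v -> runs (PIf C P Q) t v
| run_if_false C P Q t v : runs C t Leaf -> runs Q t v -> runs (PIf C P Q) t v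
| run_while_true C P t u1 u2 u v :
    runs C t (Node u1 u2) -> runs P t u -> runs (PWhile C P) u v ->
    runs (PWhile C P) t v
| run_while_false C P t : runs C t Leaf -> runs (PWhile C P) t t.

Lemma runs_fun P t u v : runs P t u -> runs P t v -> u = v.
Proof.
move=> r; elim: r v => {P t u} [t|t|t|t|P Q t u v _ IHP _ IHQ|P Q t u v _ IHP _ IHQ
  |C P Q t u1 u2 v _ IHC _ IHP|C P Q t v _ IHC _ IHQ
  |C P t u1 u2 u v _ IHC _ IHP _ IHW|C P t _ IHC] w H;
  inversion H as [| | | |? ? ? x ? rx ry|? ? ? x ? rx ry|? ? ? ? ? ? ? rx ry
    |? ? ? ? ? rx ry|? ? ? ? ? x ? rx ry rz|? ? ? rx]; subst => //;
  try by [move: (IHC _ rx)].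
- by rewrite (IHP _ rx) (IHQ _ ry).
- by move: (IHP _ rx) ry => <-; apply: IHQ.
- exact: IHP.
- exact: IHQ.
- by move: (IHP _ ry) rz => <-; apply: IHW.
Qed.

Definition code_seq (T : Type) (code : T -> tree) (s : seq T) : tree :=
  foldr (fun x t => Node (code x) t) Leaf s.
Definition code_pair (T U : Type) (codeT : T -> tree) (codeU : U -> tree)
  (x : T * U) : tree := Node (codeT x.1) (codeU x.2).
Definition code_nat (n : nat) : tree := iter n (Node Leaf) Leaf.
Definition code_bool (b : bool) : tree := if b then Node Leaf Leaf else Leaf.
Definition code_int (z : int) : tree :=
  match z with
  | Posz n => Node Leaf (code_nat n)
  | Negz n => Node (Node Leaf Leaf) (code_nat n)
  end.
Definition code_letter (X : finType) (a : letter X) : tree :=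
  Node (code_nat (enum_rank a.1)) (code_bool a.2).
Definition code_vec (m : nat) (c : m.-tuple int) : tree := code_seq code_int c.

(* Elements of the finitely generated abelian group A are handled through     *)
(* their (possibly not unique) coordinates with respect to a finite           *)
(* generating family, and elements of the free group through words.           *)
Definition lincomb (A : zmodType) (m : nat) (a : m.-tuple A)
  (c : m.-tuple int) : A := (\sum_(i < m) tnth a i *~ tnth c i)%R.

Definition generates (A : zmodType) (m : nat) (a : m.-tuple A) : Prop :=
  forall x : A, exists c, x = lincomb a c.

Notation input_elt X m := (word X * m.-tuple int)%type.

Definition denote (X : finType) (A : zmodType) (m : nat) (a : m.-tuple A)
  (x : input_elt X m) : FxA X A := (fg_of_word x.1, lincomb a x.2).

Definition span_input (X : finType) (A : zmodType) (m : nat) (a : m.-tuple A)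
  (S : seq (input_elt X m)) : set (FxA X A) :=
  generated [set denote a x | x in [set` S]].

Definition code_input (X : finType) (m : nat) (S : seq (input_elt X m)) : tree :=
  code_seq (code_pair (code_seq (@code_letter X)) (@code_vec m)) S.

(* Finite description of a finite enriched automaton: the name of the         *)
(* basepoint, the list of the names of the vertices, and the list of the arcs *)
(* (source, (coordinates of abel1, label, coordinates of abel2), target).     *)
(* Names of vertices are arbitrary trees.                                     *)
Notation arc_descr X m :=
  (tree * (m.-tuple int * letter X * m.-tuple int) * tree)%type.

Record aut_descr (X : finType) (m : nat) := AutDescr {
  descr_base : tree;
  descr_vertices : seq tree;
  descr_arcs : seq (arc_descr X m)
}.

Definition code_arc_descr (X : finType) (m : nat) : arc_descr X m -> tree :=
  code_pair
    (code_pair id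
       (code_pair (code_pair (@code_vec m) (@code_letter X)) (@code_vec m)))
    id.

Definition code_aut_descr (X : finType) (m : nat) (d : aut_descr X m) : tree :=
  Node (descr_base d)
    (Node (code_seq id (descr_vertices d))
          (code_seq (@code_arc_descr X m) (descr_arcs d))).

Section Describes.
Variables (X : finType) (A : zmodType) (m : nat) (a : m.-tuple A).
Variables (G : enriched X A) (name : vertex G -> tree).

Definition describes_arc (d : arc_descr X m) (e : arc G) : Prop :=
  let: (p, (c1, x, c2), q) := d in
  [/\ name (source e) = p, abel1 e = lincomb a c1, label e = x,
      abel2 e = lincomb a c2 & name (target e) = q].

(* In a deterministic automaton an arc is determined by its source and its    *)
(* label, so that the description determines the subautomaton, including its  *)
(* involution.                                                                *)
Definition describes (d : aut_descr X m)
    (VS : set (vertex G)) (ES : set (arc G)) : Prop :=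
  [/\ descr_base d = name (base G),
      [set` descr_vertices d] = [set name p | p in VS],
      forall e, ES e -> exists2 x, x \in descr_arcs d & describes_arc x e
    & forall x, x \in descr_arcs d -> exists2 e, ES e & describes_arc x e].

End Describes.

(* PL and PG recursively construct G from the input: PL outputs a finite      *)
(* generating set of the basepoint subgroup, and the outputs of PG with the   *)
(* additional input k = 0, 1, 2, ... form an increasing sequence of finite    *)
(* subautomata of G with union G.                                             *)
Definition recursively_constructs (X : finType) (A : zmodType) (m : nat)
    (a : m.-tuple A) (PL PG : prog) (input : tree) (G : enriched X A) : Prop :=
  (exists2 ls : seq (m.-tuple int),
     runs PL input (code_seq (@code_vec m) ls)
     & base_group G = generated ([set lincomb a c | c in [set` ls]] : set (texp A)))
  /\
  (exists (name : vertex G -> tree)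
          (VS : nat -> set (vertex G)) (ES : nat -> set (arc G)),
     injective name /\
     [/\ forall k, subautomaton (VS k) (ES k) /\
                   finite_set (VS k) /\ finite_set (ES k),
         forall k, VS k `<=` VS k.+1 /\ ES k `<=` ES k.+1,
         (forall p, exists k, VS k p) /\ (forall e, exists k, ES k e)
       & forall k, exists2 d : aut_descr X m,
           runs PG (Node input (code_nat k)) (code_aut_descr d)
           & describes a name d (VS k) (ES k)]).

(* Main.v *)
From Stdlib Require List.
From HB Require Import structures.
Require Import Defs.
From mathcomp Require Import all_boot all_order all_algebra.
From mathcomp Require Import boolp classical_sets cardinality.
From mathcomp Require Import zify.

(** Write V for the group Z^m of coordinate vectors. Adding to each generating
set finitely many relations of the generators of A (subgroups of V are finitely
generated, [subgroup_vec_fg]) replaces F x A by F x V, where a coordinate vector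
is an element and not just a name of one ([lift_inputP]). Let K1, K2 be the two
subgroups of F x V, let H be their intersection, and let pi be the projection to
F.

The Stallings automaton of H is built on the right cosets pi(H)u that lie on
reduced closed walks of the Schreier graph, each named by its representative in a
spanning tree. An arc p -l-> q carries a vector c with p l q^-1 t^c in H, put on
the side that normalization prescribes, and the group at the basepoint consists of
the images of the c with t^c in H. A walk from p to q then only reads elements g
with p g q^-1 in H ([reads_sound]), every reduced word of pi(H) labels a closed
walk, and what two elements of H over the same word differ by is read at the
basepoint; hence the automaton recognizes H ([recognized_graph]). An arc is in the
tree when p l and q are equal in F. So along a walk in the tree p times the word
read is q, and a closed one without backtracking reads a reduced word that is
trivial in F, that is, it is empty ([tree_spanning]).

Everything becomes computable once membership in pi(H) is decided with a witness
c ([completionP], [completion_some]); this has two ingredients.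

For one finitely generated K, a finite labelled automaton M decides whether a word
w is in pi(K) and finds a vector a with w t^a in K; all the other ones differ from a
by an element of the group spanned by the defects of the generators, that is, by
the c - a' with u t^c a generator and a' the vector that M reads along u
([abelian_partP]). No folding is done to get M. That M is correct is a finite set of
verifiable conditions ([valid_machine]): its arcs are invertible, it reads the
generators from the base to the base, and each of its arcs, closed up by the names
of its ends, is a product of generators. Such an M exists, namely the part of the
Schreier graph of pi(K) around the generators ([exists_valid]), so that a blind
search over all finite automata halts ([machine_search]).

For two subgroups, w is in pi(H) when the cosets a1 + L1 and a2 + L2 of V that are
read along w meet, and L1 and L2 have to be intersected. Both are the computation of
the kernel of a linear map on a group given by generators; this is one Euclidean
algorithm per coordinate ([kernelP], [coset_meet_some], [meetP]).

The representatives are those of a breadth-first search of the Schreier graph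
([tree_rep]): they are closed under prefixes, and each one only depends on the
words up to its length, so that the names do not change from one stage to the next.
Stage k consists of the vertices and arcs on closed walks that read a reduced word of
pi(H) of length at most k.

Programs are hardly ever written: a function is [computable] when some program
computes it on codes, and this property goes through pairs, conditionals,
iterations over lists, and unbounded search. The functions above are ordinary
functions on words, vectors and lists, and their computability is read off their
definitions. *)

Set Implicit Arguments.
Unset Strict Implicit.
Unset Printing Implicit Defensive.

Import GRing.Theory Num.Theory.
Local Open Scope classical_set_scope.

Generalizable Variables E T U.

(** * Computable functions *)

(** The instances below unfold to the codes prescribed for inputs and outputs
([code_letter], [code_vec], ...), so that a run on coded values is convertible to
a run on the prescribed trees. *)
Class coded (T : Type) := code : T -> tree.

#[export] Instance coded_tree : coded tree := id.
#[export] Instance coded_unit : coded unit := fun _ => Leaf.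
#[export] Instance coded_bool : coded bool := code_bool.
#[export] Instance coded_nat : coded nat := code_nat.
#[export] Instance coded_int : coded int := code_int.
#[export] Instance coded_pair T U (cT : coded T) (cU : coded U) :
  coded (T * U) := code_pair cT cU.
#[export] Instance coded_seq T (cT : coded T) : coded (seq T) := code_seq cT.
#[export] Instance coded_option T (cT : coded T) : coded (option T) :=
  fun o => if o is Some x then Node (code x) Leaf else Leaf.
#[export] Instance coded_fin (X : finType) : coded X | 10 :=
  fun x => code_nat (enum_rank x).
#[export] Instance coded_tuple m T (cT : coded T) : coded (m.-tuple T) :=
  fun t => code_seq cT t.

(** The proof of computability follows the syntax of the body of a function: the
head constant selects the closure property, hence no constant may be unfolded,
except [predArgType], which is a mere alias of [Type]. *)
Create HintDb computability discriminated.
#[export] Hint Constants Opaque : computability.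
#[export] Hint Transparent predArgType : computability.

Definition computable T U {cT : coded T} {cU : coded U} (f : T -> U) : Prop :=
  exists P, forall x, runs P (code x) (code (f x)).

Lemma computable_fst E (cE : coded E) T (cT : coded T) U (cU : coded U) (g : E -> T * U) :
  computable g -> computable (fun x => (g x).1).
Proof.
move=> [P HP]; exists (PSeq P PHead) => x; apply: run_seq (HP x) _.
exact: (run_head (code (g x))).
Qed.

Lemma computable_snd E (cE : coded E) T (cT : coded T) U (cU : coded U) (g : E -> T * U) :
  computable g -> computable (fun x => (g x).2).
Proof.
move=> [P HP]; exists (PSeq P PTail) => x; apply: run_seq (HP x) _.
exact: (run_tail (code (g x))).
Qed.

Lemma computable_proj1 T (cT : coded T) U (cU : coded U) : computable (fst : T * U -> T).
Proof. by exists PHead => x; apply: (run_head (code x)). Qed.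

Lemma computable_proj2 T (cT : coded T) U (cU : coded U) : computable (snd : T * U -> U).
Proof. by exists PTail => x; apply: (run_tail (code x)). Qed.

#[export] Hint Resolve computable_fst computable_snd computable_proj1
  computable_proj2 : computability.

Section Basic.
Context {E T U W : Type} {cE : coded E} {cT : coded T} {cU : coded U}
  {cW : coded W}.

(** Only codes matter to a program: values of different types with the same code are
interchangeable, which moves computability across representations. *)
Lemma computable_code (f : E -> T) (g : E -> U) :
  (forall x, code (f x) = code (g x)) -> computable g -> computable f.
Proof. by move=> fg [P Pg]; exists P => x; rewrite fg. Qed.

Lemma computable_id : computable (fun x : E => x).
Proof. by exists PSkip => x; constructor. Qed.

Lemma computable_const (c : T) : computable (fun _ : E => c).
Proof.
have [P HP] : exists P, forall t, runs P t (code c).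
  elim: (code c) => [|u [P HP] v [Q HQ]]; first by exists PLeaf => t; constructor.
  by exists (PNode P Q) => t; constructor.
by exists P.
Qed.

Lemma computable_comp (g : T -> U) (h : E -> T) :
  computable g -> computable h -> computable (fun x => g (h x)).
Proof.
move=> [P HP] [Q HQ]; exists (PSeq Q P) => x; exact: run_seq (HQ x) (HP _).
Qed.

Lemma computable_pair (g : E -> T) (h : E -> U) :
  computable g -> computable h -> computable (fun x => (g x, h x)).
Proof. by move=> [P HP] [Q HQ]; exists (PNode P Q) => x; constructor. Qed.

Lemma computable_if (c : E -> bool) (f g : E -> T) :
  computable c -> computable f -> computable g -> computable (fun x => if c x then f x else g x).
Proof.
move=> [C HC] [P HP] [Q HQ]; exists (PIf C P Q) => x; move: (HC x).
by case: (c x) => r; [apply: run_if_true r _ | apply: run_if_false r _].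
Qed.

Lemma computable_cons (g : E -> T) (h : E -> seq T) :
  computable g -> computable h -> computable (fun x => g x :: h x).
Proof. by move=> [P HP] [Q HQ]; exists (PNode P Q) => x; constructor. Qed.

Lemma computable_Some (g : E -> T) : computable g -> computable (fun x => Some (g x)).
Proof.
move=> [P HP]; exists (PNode P PLeaf) => x.
by apply: run_node (HP x) _; constructor.
Qed.

Lemma computable_seqcase (s : E -> seq T) (f : E -> T -> seq T -> U) (g : E -> U) :
  computable s -> computable (fun p : E * (T * seq T) => f p.1 p.2.1 p.2.2) -> computable g ->
  computable (fun x => if s x is y :: s' then f x y s' else g x).
Proof.
move=> [S HS] [P HP] [Q HQ]; exists (PIf S (PSeq (PNode PSkip S) P) Q) => x.
move: (HS x); case: (s x) => [|y s'] r; first exact: run_if_false r _.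
apply: run_if_true (r) _; apply: run_seq (HP (x, (y, s'))).
by apply: run_node (r); constructor.
Qed.

Lemma computable_treecase (t : E -> tree) (f : E -> tree -> tree -> U) (g : E -> U) :
  computable t -> computable (fun p : E * (tree * tree) => f p.1 p.2.1 p.2.2) ->
  computable g ->
  computable (fun x => if t x is Node u v then f x u v else g x).
Proof.
move=> [S HS] [P HP] [Q HQ]; exists (PIf S (PSeq (PNode PSkip S) P) Q) => x.
move: (HS x); rewrite /code /coded_tree.
case: (t x) => [|u v] r; first exact: run_if_false r _.
apply: run_if_true (r) _; apply: run_seq (HP (x, (u, v))).
by apply: run_node (r); constructor.
Qed.

Lemma computable_option (s : E -> option T) (f : E -> T -> U) (g : E -> U) :
  computable s -> computable (fun p : E * T => f p.1 p.2) -> computable g ->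
  computable (fun x => if s x is Some y then f x y else g x).
Proof.
move=> [S HS] [P HP] [Q HQ].
exists (PIf S (PSeq (PNode PSkip (PSeq S PHead)) P) Q) => x.
move: (HS x); case: (s x) => [y|] r; last exact: run_if_false r _.
apply: run_if_true (r) _; apply: run_seq (HP (x, y)).
apply: run_node; first by constructor.
by apply: run_seq (r) _; apply: (run_head (Node (code y) Leaf)).
Qed.

(** The loop works on the tree (x, (accumulator, rest)); the code of the rest is
[Leaf], the false value, exactly when it is empty. *)
Lemma computable_foldl (b : E -> U -> T -> U) (z : E -> U) (s : E -> seq T) :
  computable (fun p : E * (U * T) => b p.1 p.2.1 p.2.2) -> computable z -> computable s ->
  computable (fun x => foldl (b x) (z x) (s x)).
Proof.
move=> [B HB] [Z HZ] [S HS].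
pose arg := PNode PHead
  (PNode (PSeq PTail PHead) (PSeq PTail (PSeq PTail PHead))).
pose body := PNode PHead
  (PNode (PSeq arg B) (PSeq PTail (PSeq PTail PTail))).
exists (PSeq (PNode PSkip (PNode Z S))
  (PSeq (PWhile (PSeq PTail PTail) body) (PSeq PTail PHead))) => x.
have path t u v : runs (PSeq PTail PHead) (Node t (Node u v)) u.
  apply: run_seq (run_tail _) _ => /=; exact: (run_head (Node u v)).
have path2 t u v : runs (PSeq PTail PTail) (Node t (Node u v)) v.
  apply: run_seq (run_tail _) _ => /=; exact: (run_tail (Node u v)).
apply: (@run_seq _ _ _ (code (x, (z x, s x)))).
  by apply: run_node; [constructor | apply: run_node].
apply: (@run_seq _ _ _ (code (x, (foldl (b x) (z x) (s x), [::] : seq T))));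
  last exact: path.
elim: (s x) (z x) => [|y l IHl] a.
  by apply: run_while_false; apply: path2.
apply: (@run_while_true _ _ _ (code y) (code l) (code (x, (b x a y, l))));
  [exact: path2 | | exact: IHl].
apply: run_node; first exact: (run_head (Node _ _)).
apply: run_node.
  apply: run_seq (HB (x, (a, y))).
  apply: run_node; first exact: (run_head (Node _ _)).
  apply: run_node; first exact: path.
  apply: run_seq (run_tail _) _; apply: run_seq (run_tail _) _.
  exact: (run_head (Node _ _)).
apply: run_seq (run_tail _) _; apply: run_seq (run_tail _) _.
exact: (run_tail (Node _ _)).
Qed.

(** The only source of unbounded computation: a counter is increased until the test
succeeds. *)
Lemma computable_ex_minn (c : E -> nat -> bool) (H : forall x, exists n, c x n) :
  computable (fun p : E * nat => c p.1 p.2) -> computable (fun x => ex_minn (H x)).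
Proof.
move=> [C HC].
pose cond := PIf C PLeaf (PNode PLeaf PLeaf).
pose body := PNode PHead (PNode PLeaf PTail).
exists (PSeq (PNode PSkip PLeaf) (PSeq (PWhile cond body) PTail)) => x.
case: ex_minnP => n cn minn.
apply: (@run_seq _ _ _ (code (x, 0))).
  by apply: run_node; constructor.
apply: (@run_seq _ _ _ (code (x, n))); last exact: (run_tail (Node _ _)).
pose state (k : nat) := @code _ (coded_pair cE coded_nat) (x, k).
suff loop k : k <= n -> runs (PWhile cond body) (state (n - k)) (state n).
  by have := loop n (leqnn n); rewrite subnn.
elim: k => [|k IHk] lek.
  rewrite subn0; apply: run_while_false.
  move: (HC (x, n)); rewrite /= cn => r; apply: run_if_true r _; constructor.
have nlek : c x (n - k.+1) = false by apply/negP => /minn; lia.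
apply: (@run_while_true _ _ _ Leaf Leaf (state (n - k))); last by apply: IHk; lia.
  move: (HC (x, n - k.+1)); rewrite /= nlek => r; apply: run_if_false r _.
  by apply: run_node; constructor.
have -> : n - k = (n - k.+1).+1 by lia.
apply: run_node; first exact: (run_head (Node _ _)).
apply: run_node; first by constructor.
exact: (run_tail (Node _ _)).
Qed.

Lemma computable_ext (f g : E -> T) : f =1 g -> computable g -> computable f.
Proof. by move=> fg [P Pg]; exists P => x; rewrite fg. Qed.

Lemma computable_comp2 (g : T -> U -> W) (h : E -> T) (k : E -> U) :
  computable (fun p => g p.1 p.2) -> computable h -> computable k ->
  computable (fun x => g (h x) (k x)).
Proof.
move=> [G HG] [P HP] [Q HQ]; exists (PSeq (PNode P Q) G) => x.
exact: run_seq (run_node (HP x) (HQ x)) (HG (h x, k x)).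
Qed.

Lemma computable_comp3 V (cV : coded V) (g : T -> U -> W -> V)
  (h : E -> T) (k : E -> U) (l : E -> W) :
  computable (fun p => g p.1 p.2.1 p.2.2) -> computable h -> computable k ->
  computable l -> computable (fun x => g (h x) (k x) (l x)).
Proof.
move=> [G HG] [P HP] [Q HQ] [R HR].
exists (PSeq (PNode P (PNode Q R)) G) => x.
exact: run_seq (run_node (HP x) (run_node (HQ x) (HR x))) (HG (h x, (k x, l x))).
Qed.

End Basic.
#[export] Hint Resolve computable_id computable_pair computable_if
  computable_cons computable_Some computable_seqcase computable_treecase
  computable_option computable_foldl computable_ex_minn : computability.

(** A body that does not depend on the argument is matched first, whatever its head;
then come functions of several arguments whose computability is a hypothesis, stated
on tuples. *)
#[export] Hint Extern 0 (computable (fun _ => ?c)) =>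
  exact (computable_const c) : computability.
#[export] Hint Extern 3 (computable _) =>
  match goal with
  | H : computable (fun p => ?f p.1 p.2)
    |- computable (fun x => ?f (@?h x) (@?k x)) =>
    refine (computable_comp2 (g := f) (h := h) (k := k) H _ _)
  | H : computable (fun p => ?f p.1 p.2.1 p.2.2)
    |- computable (fun x => ?f (@?h x) (@?k x) (@?l x)) =>
    refine (computable_comp3 (g := f) (h := h) (k := k) (l := l) H _ _ _)
  | H : computable ?f |- computable (fun x => ?f (@?h x)) =>
    refine (computable_comp (g := f) (h := h) H _)
  end : computability.
(** Local definitions are expanded, hence recomputed at each occurrence, so that no
closure property is needed for them. *)
Ltac computability := cbv zeta; typeclasses eauto with computability.

(** * Lists, numbers and equality *)

Lemma computable_negb `{coded E} (b : E -> bool) :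
  computable b -> computable (fun x => ~~ b x).
Proof.
by move=> cb; apply: (@computable_ext _ _ _ _ _ (fun x => if b x then false else true));
  [move=> x; case: (b x) | computability].
Qed.
#[export] Hint Resolve computable_negb : computability.

Lemma computable_andb `{coded E} (b c : E -> bool) :
  computable b -> computable c -> computable (fun x => b x && c x).
Proof. by move=> cb cc; rewrite /andb; computability. Qed.
#[export] Hint Resolve computable_andb : computability.

Lemma computable_rev `{coded E, coded T} (s : E -> seq T) :
  computable s -> computable (fun x => rev (s x)).
Proof.
move=> cs.
apply: (@computable_ext _ _ _ _ _ (fun x => foldl (fun acc y => y :: acc) [::] (s x)));
  last by computability.
move=> x; rewrite /rev; move: (s x) [::]; elim=> //= y l IHl a; exact: IHl.
Qed.
#[export] Hint Resolve computable_rev : computability.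

Lemma computable_foldr `{coded E, coded T, coded U} (b : E -> T -> U -> U) (z : E -> U) (s : E -> seq T) :
  computable (fun p : E * (T * U) => b p.1 p.2.1 p.2.2) -> computable z ->
  computable s -> computable (fun x => foldr (b x) (z x) (s x)).
Proof.
move=> cb cz cs.
apply: (@computable_ext _ _ _ _ _
  (fun x => foldl (fun acc y => b x y acc) (z x) (rev (s x)))).
  by move=> x; rewrite foldl_rev.
computability.
Qed.
#[export] Hint Resolve computable_foldr : computability.

Lemma computable_orb `{coded E} (b c : E -> bool) :
  computable b -> computable c -> computable (fun x => b x || c x).
Proof. by move=> cb cc; rewrite /orb; computability. Qed.
#[export] Hint Resolve computable_orb : computability.

Lemma computable_map `{coded E, coded T, coded U} (f : E -> T -> U) (s : E -> seq T) :
  computable (fun p : E * T => f p.1 p.2) -> computable s ->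
  computable (fun x => map (f x) (s x)).
Proof.
move=> cf cs.
apply: (@computable_ext _ _ _ _ _
  (fun x => foldr (fun y acc => f x y :: acc) [::] (s x))).
  by move=> x; elim: (s x) => //= y l ->.
computability.
Qed.
#[export] Hint Resolve computable_map : computability.

Lemma computable_filter `{coded E, coded T} (f : E -> T -> bool) (s : E -> seq T) :
  computable (fun p : E * T => f p.1 p.2) -> computable s ->
  computable (fun x => filter (f x) (s x)).
Proof.
move=> cf cs.
apply: (@computable_ext _ _ _ _ _
  (fun x => foldr (fun y acc => if f x y then y :: acc else acc) [::] (s x))).
  by move=> x; elim: (s x) => //= y l ->.
computability.
Qed.
#[export] Hint Resolve computable_filter : computability.

Lemma computable_has `{coded E, coded T} (f : E -> T -> bool) (s : E -> seq T) :
  computable (fun p : E * T => f p.1 p.2) -> computable s ->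
  computable (fun x => has (f x) (s x)).
Proof.
move=> cf cs.
apply: (@computable_ext _ _ _ _ _
  (fun x => foldr (fun y acc => f x y || acc) false (s x))).
  by move=> x; elim: (s x) => //= y l ->.
computability.
Qed.
#[export] Hint Resolve computable_has : computability.

Lemma computable_cat `{coded E, coded T} (s t : E -> seq T) :
  computable s -> computable t -> computable (fun x => s x ++ t x).
Proof.
move=> cs ct.
apply: (@computable_ext _ _ _ _ _ (fun x => foldr cons (t x) (s x)));
  last by computability.
by move=> x; elim: (s x) => //= y l ->.
Qed.
#[export] Hint Resolve computable_cat : computability.

Lemma computable_rcons `{coded E, coded T} (s : E -> seq T) (y : E -> T) :
  computable s -> computable y -> computable (fun x => rcons (s x) (y x)).
Proof.
move=> cs cy; apply: (@computable_ext _ _ _ _ _ (fun x => s x ++ [:: y x])).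
  by move=> x; rewrite cats1.
computability.
Qed.
#[export] Hint Resolve computable_rcons : computability.

Lemma computable_head `{coded E, coded T} (d : E -> T) (s : E -> seq T) :
  computable d -> computable s -> computable (fun x => head (d x) (s x)).
Proof. by move=> cd cs; rewrite /head; computability. Qed.
#[export] Hint Resolve computable_head : computability.

Lemma computable_behead `{coded E, coded T} (s : E -> seq T) :
  computable s -> computable (fun x => behead (s x)).
Proof. by move=> cs; rewrite /behead; computability. Qed.
#[export] Hint Resolve computable_behead : computability.

Lemma computable_S `{coded E} (n : E -> nat) :
  computable n -> computable (fun x => (n x).+1).
Proof.
by move=> [P HP]; exists (PNode PLeaf P) => x; apply: run_node (HP x); constructor.
Qed.
#[export] Hint Resolve computable_S : computability.

(** A number has the code of a list of as many units, so that a case on a number is a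
case on a list; iteration is obtained in the same way. *)
Lemma computable_natcase `{coded E, coded U} (n : E -> nat) (f : E -> nat -> U) (g : E -> U) :
  computable n -> computable (fun p : E * nat => f p.1 p.2) -> computable g ->
  computable (fun x => if n x is k.+1 then f x k else g x).
Proof.
move=> cn cf cg.
apply: (@computable_ext _ _ _ _ _
  (fun x => if nseq (n x) tt is y :: s then f x (size s) else g x)).
  by move=> x; case: (n x) => //= k; rewrite size_nseq.
have code_nseq k : code_seq (fun _ : unit => Leaf) (nseq k tt) = code_nat k.
  by elim: k => //= k ->.
apply: computable_seqcase cg.
  by apply: (computable_code (g := n)) => // x; apply: code_nseq.
have cp : computable (fun p : E * (unit * seq unit) => (p.1, size p.2.2)).
  apply: computable_pair; first by computability.
  apply: (@computable_code _ _ _ _ _ _ _ (fun p : E * (unit * seq unit) => p.2.2)).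
    case=> x [[] s]; rewrite /code /coded_seq /coded_nat /=.
    by elim: s => //= -[] s ->.
  computability.
exact: (computable_comp cf cp).
Qed.
#[export] Hint Resolve computable_natcase : computability.

Lemma computable_iter `{coded E, coded T} (n : E -> nat) (f : E -> T -> T) (z : E -> T) :
  computable n -> computable (fun p : E * T => f p.1 p.2) -> computable z ->
  computable (fun x => iter (n x) (f x) (z x)).
Proof.
move=> cn cf cz.
apply: (@computable_ext _ _ _ _ _
  (fun x => foldr (fun _ : unit => f x) (z x) (nseq (n x) tt))).
  by move=> x; elim: (n x) => //= k ->.
apply: computable_foldr => //.
  computability.
apply: (computable_code (g := n)) => // x.
by rewrite /code /coded_seq; elim: (n x) => //= k ->.
Qed.
#[export] Hint Resolve computable_iter : computability.

Lemma computable_all `{coded E, coded T} (f : E -> T -> bool) (s : E -> seq T) :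
  computable (fun p : E * T => f p.1 p.2) -> computable s ->
  computable (fun x => all (f x) (s x)).
Proof.
move=> cf cs.
apply: (@computable_ext _ _ _ _ _ (fun x => ~~ has (fun y => ~~ f x y) (s x))).
  by move=> x; rewrite has_predC negbK.
computability.
Qed.
#[export] Hint Resolve computable_all : computability.

Lemma computable_flatten `{coded E, coded T} (s : E -> seq (seq T)) :
  computable s -> computable (fun x => flatten (s x)).
Proof. by move=> cs; rewrite /flatten; computability. Qed.
#[export] Hint Resolve computable_flatten : computability.

Lemma computable_size `{coded E, coded T} (s : E -> seq T) :
  computable s -> computable (fun x => size (s x)).
Proof.
move=> cs; apply: (@computable_ext _ _ _ _ _ (fun x => foldr (fun _ => S) 0 (s x))).
  by move=> x; elim: (s x) => //= y l ->.
computability.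
Qed.
#[export] Hint Resolve computable_size : computability.

Lemma computable_nth `{coded E, coded T} (d : E -> T) (s : E -> seq T) (n : E -> nat) :
  computable d -> computable s -> computable n ->
  computable (fun x => nth (d x) (s x) (n x)).
Proof.
move=> cd cs cn.
apply: (@computable_ext _ _ _ _ _ (fun x => head (d x) (iter (n x) behead (s x)))).
  move=> x; elim: (n x) (s x) => [|k IHk] [|y l] //=.
    by rewrite -iterS iterSr -IHk /= nth_nil.
  by rewrite -iterS iterSr /= IHk.
computability.
Qed.
#[export] Hint Resolve computable_nth : computability.

Lemma computable_pred `{coded E} (n : E -> nat) :
  computable n -> computable (fun x => (n x).-1).
Proof. by move=> cn; rewrite /Nat.pred; computability. Qed.
#[export] Hint Resolve computable_pred : computability.

Lemma computable_addn `{coded E} (n k : E -> nat) :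
  computable n -> computable k -> computable (fun x => n x + k x).
Proof.
move=> cn ck; apply: (@computable_ext _ _ _ _ _ (fun x => iter (n x) S (k x))).
  by move=> x; elim: (n x) => //= i <-.
computability.
Qed.
#[export] Hint Resolve computable_addn : computability.

Lemma computable_subn `{coded E} (n k : E -> nat) :
  computable n -> computable k -> computable (fun x => n x - k x).
Proof.
move=> cn ck; apply: (@computable_ext _ _ _ _ _ (fun x => iter (k x) predn (n x))).
  by move=> x; elim: (k x) => [|i /= <-]; rewrite ?subn0 ?subnS.
computability.
Qed.
#[export] Hint Resolve computable_subn : computability.

Lemma computable_leq `{coded E} (n k : E -> nat) :
  computable n -> computable k -> computable (fun x => n x <= k x).
Proof.
move=> cn ck.
apply: (@computable_ext _ _ _ _ _ (fun x => if n x - k x is _.+1 then false else true)).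
  by move=> x; rewrite /leq; case: (n x - k x).
computability.
Qed.
#[export] Hint Resolve computable_leq : computability.

Definition int_sign (z : int) : bool := if z is Negz _ then true else false.
Definition int_size (z : int) : nat := match z with Posz n => n | Negz n => n end.

Lemma computable_Posz `{coded E} (n : E -> nat) :
  computable n -> computable (fun x => Posz (n x)).
Proof.
move=> cn; apply: (computable_code (g := fun x => (false, n x))) => //.
computability.
Qed.
#[export] Hint Resolve computable_Posz : computability.

Lemma computable_Negz `{coded E} (n : E -> nat) :
  computable n -> computable (fun x => Negz (n x)).
Proof.
move=> cn; apply: (computable_code (g := fun x => (true, n x))) => //.
computability.
Qed.
#[export] Hint Resolve computable_Negz : computability.

(** An integer is coded as the pair of its constructor and of the number it holds. *)
Lemma computable_intcase `{coded E, coded T} (z : E -> int) (f g : E -> nat -> T) :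
  computable z -> computable (fun p : E * nat => f p.1 p.2) ->
  computable (fun p : E * nat => g p.1 p.2) ->
  computable (fun x => match z x with Posz n => f x n | Negz n => g x n end).
Proof.
move=> cz cf cg.
have cp : computable (fun x => (int_sign (z x), int_size (z x))).
  by apply: (computable_code (g := z)) => // x; case: (z x).
apply: (@computable_ext _ _ _ _ _ (fun x =>
  if (int_sign (z x), int_size (z x)).1 then g x (int_sign (z x), int_size (z x)).2
  else f x (int_sign (z x), int_size (z x)).2)).
  by move=> x; case: (z x).
have cn : computable (fun x => (x, (int_sign (z x), int_size (z x)).2)).
  by computability.
apply: computable_if; first by computability.
  exact: (computable_comp cg cn).
exact: (computable_comp cf cn).
Qed.
#[export] Hint Resolve computable_intcase : computability.

Definition int_add (y z : int) : int := (y + z)%R.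
Definition int_opp (z : int) : int := (- z)%R.

Lemma computable_int_add `{coded E} (y z : E -> int) :
  computable y -> computable z -> computable (fun x => int_add (y x) (z x)).
Proof.
apply: computable_comp2.
apply: (@computable_ext _ _ _ _ _ (fun p => intZmod.addz p.1 p.2)) => //.
by rewrite /intZmod.addz; computability.
Qed.

Lemma computable_int_opp `{coded E} (z : E -> int) :
  computable z -> computable (fun x => int_opp (z x)).
Proof.
apply: computable_comp.
apply: (@computable_ext _ _ _ _ _ intZmod.oppz) => //.
by rewrite /intZmod.oppz; computability.
Qed.
#[export] Hint Resolve computable_int_add computable_int_opp : computability.

Lemma computable_absz `{coded E} (z : E -> int) :
  computable z -> computable (fun x => absz (z x)).
Proof. by move=> cz; rewrite /absz; computability. Qed.
#[export] Hint Resolve computable_absz : computability.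

(** Equality is tested on codes, so that one program serves all types. *)
Definition same_code T {cT : coded T} (x y : T) : bool := code x == code y.

(** One step of the comparison of two trees: the list holds the pairs of subtrees
that remain to be compared, the boolean is the verdict so far. *)
Definition eq_step (p : seq (tree * tree) * bool) : seq (tree * tree) * bool :=
  if p.1 is tu :: s then
    if tu.1 is Node a b then
      if tu.2 is Node c d then ((a, c) :: (b, d) :: s, p.2) else ([::], false)
    else if tu.2 is Node _ _ then ([::], false) else (s, p.2)
  else p.

Lemma eq_step_iter t u s r : exists n,
  iter n eq_step ((t, u) :: s, r) = if t == u then (s, r) else ([::], false).
Proof.
elim: t u s => [|t1 IH1 t2 IH2] [|u1 u2] s; try by exists 1.
have [n1 IHn1] := IH1 u1 ((t2, u2) :: s); have [n2 IHn2] := IH2 u2 s.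
have stop k : iter k eq_step ([::], false) = ([::], false).
  by elim: k => //= k ->.
exists (n2 + (n1 + 1)); rewrite !iterD /= /eq_step /= IHn1.
have -> : (Node t1 t2 == Node u1 u2) = (t1 == u1) && (t2 == u2) by [].
by case: (t1 == u1) => /=; rewrite ?stop ?IHn2.
Qed.

(** The comparison stops after some number of steps; this number is found by
search, so that no bound has to be computed. *)
Lemma computable_same_code (E T : Type) (cE : coded E) (cT : coded T) (f g : E -> T) :
  computable f -> computable g -> computable (fun x => same_code (f x) (g x)).
Proof.
move=> cf cg.
have ex (p : tree * tree) : exists n, nilp (iter n eq_step ([:: p], true)).1.
  have [n Hn] := eq_step_iter p.1 p.2 [::] true.
  by exists n; rewrite -surjective_pairing in Hn; rewrite Hn; case: ifP.
have cstep (E' : Type) (cE' : coded E') (h : E' -> _) :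
    computable h -> computable (fun x => eq_step (h x)).
  by apply: computable_comp; rewrite /eq_step; computability.
have ceq : computable (fun p : tree * tree =>
    (iter (ex_minn (ex p)) eq_step ([:: p], true)).2).
  apply: computable_snd; apply: computable_iter; try computability.
  apply: computable_ex_minn.
  apply: (@computable_ext _ _ _ _ _ (fun p : (tree * tree) * nat =>
    if (iter p.2 eq_step ([:: p.1], true)).1 is _ :: _ then false else true)).
    by move=> p; case: (_.1).
  computability.
apply: (@computable_ext _ _ _ _ _ (fun x => (iter
  (ex_minn (ex (code (f x), code (g x)))) eq_step ([:: (code (f x), code (g x))], true)).2)).
  move=> x; case: ex_minnP => n n0 minn.
  have [k Hk] := eq_step_iter (code (f x)) (code (g x)) [::] true.
  have nk : n <= k by apply: minn; rewrite Hk; case: ifP.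
  move: n0 Hk; rewrite /same_code -(subnK nk) iterD; case: (iter n _ _) => -[|//] r _.
  have -> : iter (k - n) eq_step ([::], r) = ([::], r) by elim: (k - n) => //= i ->.
  by case: ifP => _ [].
apply: (computable_comp (h := fun x => (code (f x), code (g x))) ceq).
by apply: computable_pair; [exact: (computable_code (g := f))
  | exact: (computable_code (g := g))].
Qed.
#[export] Hint Resolve computable_same_code : computability.

Class injective_code T {cT : coded T} : Prop := code_inj : injective (@code T cT).
Arguments injective_code T {cT}.

Lemma same_codeE (T : eqType) {cT : coded T} {iT : injective_code T} (x y : T) :
  same_code x y = (x == y).
Proof. exact: (inj_eq code_inj). Qed.

Lemma code_nat_inj : injective code_nat.
Proof. by elim=> [|n IHn] [|k] // [/IHn ->]. Qed.

#[export] Instance injective_code_bool : injective_code bool.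
Proof. by move=> [] []. Qed.

#[export] Instance injective_code_int : injective_code int.
Proof. by move=> [] n [] k // [/code_nat_inj ->]. Qed.

#[export] Instance injective_code_fin (X : finType) : @injective_code X (@coded_fin X).
Proof. by move=> x y /code_nat_inj /val_inj /enum_rank_inj. Qed.

#[export] Instance injective_code_pair T U {cT : coded T} {cU : coded U}
  {iT : injective_code T} {iU : injective_code U} : injective_code (T * U).
Proof. by move=> [x y] [x' y'] [/iT -> /iU ->]. Qed.

#[export] Instance injective_code_seq T {cT : coded T} {iT : injective_code T} :
  injective_code (seq T).
Proof. by elim=> [|x s IHs] [|y t] // [/iT -> /IHs ->]. Qed.

(** * Spans and the Euclidean algorithm *)

Local Open Scope ring_scope.

Section Span.
Variable V : zmodType.
Implicit Types (gs hs : seq V) (x y g h : V).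

(** The impredicative form gives the closure properties and the induction principle
by instantiation. *)
Definition zspan gs x : Prop := forall P : V -> Prop,
  P 0 -> (forall y z, P y -> P z -> P (y - z)) -> (forall g, g \in gs -> P g) -> P x.

Lemma subrACA x y z t : x - y - (z - t) = (x - z) - (y - t).
Proof.
rewrite !opprB -!addrA; congr (_ + _).
by rewrite addrCA [RHS]addrCA; congr (_ + _); rewrite addrC.
Qed.

Lemma zspan0 gs : zspan gs 0.
Proof. by move=> P. Qed.

Lemma zspanB gs x y : zspan gs x -> zspan gs y -> zspan gs (x - y).
Proof. by move=> sx sy P P0 PB Pg; exact: PB (sx _ P0 PB Pg) (sy _ P0 PB Pg). Qed.

Lemma zspanN gs x : zspan gs x -> zspan gs (- x).
Proof. by move=> sx; rewrite -sub0r; apply: zspanB => //; apply: zspan0. Qed.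

Lemma zspanD gs x y : zspan gs x -> zspan gs y -> zspan gs (x + y).
Proof. by move=> sx sy; rewrite -[y]opprK; apply: zspanB => //; apply: zspanN. Qed.

Lemma zspan_mem gs x : x \in gs -> zspan gs x.
Proof. by move=> gx P _ _; apply. Qed.

Lemma zspanMz gs x n : zspan gs x -> zspan gs (x *~ n).
Proof.
have nat_case k : zspan gs x -> zspan gs (x *+ k).
  move=> sx; elim: k => [|k IHk]; first by rewrite mulr0n; apply: zspan0.
  by rewrite mulrS; apply: zspanD.
case: n => k sx; first by rewrite -pmulrn; apply: nat_case.
by rewrite NegzE mulrNz -pmulrn; apply: zspanN; apply: nat_case.
Qed.

Lemma sub_zspan gs hs x :
  (forall g, g \in gs -> zspan hs g) -> zspan gs x -> zspan hs x.
Proof. by move=> gh sx; apply: sx => //; apply: zspanB. Qed.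

(** Hence a vector of the span of g :: gs is determined, up to the span of gs, by one
integer coefficient. *)
Lemma zspan_cons g gs x : zspan (g :: gs) x -> exists n : int, zspan gs (x - g *~ n).
Proof.
move=> sx; apply: (sx (fun x => exists n : int, zspan gs (x - g *~ n))).
- by exists 0; rewrite mulr0z subr0; apply: zspan0.
- move=> y z [n Hn] [k Hk]; exists (n - k).
  by rewrite mulrzBr subrACA; apply: zspanB.
- move=> y; rewrite inE => /predU1P[->|gy].
    by exists 1; rewrite mulr1z subrr; apply: zspan0.
  by exists 0; rewrite mulr0z subr0; apply: zspan_mem.
Qed.

End Span.

Lemma zspan_image (V W : zmodType) (phi : V -> W) (gs : seq V) x :
  (forall y z, phi (y - z) = phi y - phi z) ->
  zspan gs x -> zspan (map phi gs) (phi x).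
Proof.
move=> phiB sx; apply: (sx (fun x => zspan (map phi gs) (phi x))).
- by rewrite -[0](subrr 0) phiB subrr; apply: zspan0.
- by move=> y z sy sz; rewrite phiB; apply: zspanB.
- by move=> g gg; apply: zspan_mem; apply: map_f.
Qed.

Section AdditiveFunction.
Variables (V W : zmodType) (f : V -> W).
Hypothesis fB : forall x y, f (x - y) = f x - f y.

Lemma additive_fun0 : f 0 = 0. Proof. by have := fB 0 0; rewrite !subrr. Qed.
Lemma additive_funN x : f (- x) = - f x.
Proof. by have := fB 0 x; rewrite additive_fun0 !sub0r. Qed.
Lemma additive_funD x y : f (x + y) = f x + f y.
Proof. by have := fB x (- y); rewrite additive_funN !opprK. Qed.
Lemma additive_funMz x (n : int) : f (x *~ n) = f x *~ n.
Proof.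
have nat_case k : f (x *+ k) = f x *+ k.
  by elim: k => [|k IHk]; [rewrite !mulr0n additive_fun0 | rewrite !mulrS additive_funD IHk].
by case: n => k; rewrite ?NegzE ?mulrNz -!pmulrn ?additive_funN nat_case.
Qed.

End AdditiveFunction.

Section Euclid.
Variables (V : zmodType) (f : V -> int).
Hypothesis fB : forall x y, f (x - y) = f x - f y.
Implicit Types (gs hs : seq V) (x y g h : V).

(** Names for the operations whose types mention V itself and not a projection of
its structure, as the syntactic search for computability requires. *)
Definition zzero : V := 0.
Definition zadd x y : V := x + y.
Definition zsub x y : V := x - y.

Let functional0 : f 0 = 0. Proof. exact: additive_fun0. Qed.
Let functionalN x : f (- x) = - f x. Proof. exact: additive_funN. Qed.
Let functionalD x y : f (x + y) = f x + f y. Proof. exact: additive_funD. Qed.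
Let functionalMz x (n : int) : f (x *~ n) = f x * n.
Proof. by rewrite (additive_funMz fB) mulrzz. Qed.

(** Chooses the sign for which the value decreases, hence
|f (reduce_by g h)| = |f g| - |f h| when |f h| <= |f g|. *)
Definition reduce_by (g h : V) : V :=
  if (absz (f (zsub g h)) < absz (f (zadd g h)))%N then zsub g h else zadd g h.

Definition euclid_step (p : V * V) : V * V :=
  if (absz (f p.1) < absz (f p.2))%N
  then (reduce_by p.2 p.1, p.1) else (reduce_by p.1 p.2, p.2).

(** While both values are nonzero each step decreases the sum of the absolute values,
so as many steps as the initial sum suffice to make one of them vanish. *)
Definition euclid_pair (p : V * V) : V * V :=
  let q := iter (absz (f p.1) + absz (f p.2)) euclid_step p in
  if absz (f q.1) is _.+1 then q else (q.2, q.1).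

(** Running gcd: all the generators but the first component of the result are moved
into the kernel of f, with the same span. *)
Definition euclid (gs : seq V) : V * seq V :=
  foldr (fun h acc => let q := euclid_pair (h, acc.1) in (q.1, q.2 :: acc.2))
    (zzero, [::]) gs.

(** The first component is dropped unless f vanishes on it. *)
Definition kernel (gs : seq V) : seq V :=
  let e := euclid gs in if absz (f e.1) is _.+1 then e.2 else e.1 :: e.2.

Definition same_pair (p q : V * V) : Prop :=
  forall hs, (zspan hs p.1 /\ zspan hs p.2) <-> (zspan hs q.1 /\ zspan hs q.2).

Lemma reduce_by_span g h hs : zspan hs h ->
  zspan hs g <-> zspan hs (reduce_by g h).
Proof.
move=> sh; rewrite /reduce_by /zsub /zadd; case: ifP => _; split=> s.
- exact: zspanB.
- by rewrite -[g](subrK h); apply: zspanD.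
- exact: zspanD.
- by rewrite -[g](addrK h); apply: zspanB.
Qed.

Lemma euclid_step_span p : same_pair p (euclid_step p).
Proof.
move=> hs; rewrite /euclid_step; case: ifP => _ /=.
  split=> -[s1 s2]; split=> //; first exact: (reduce_by_span _ s1).1.
  exact: (reduce_by_span _ s2).2.
by split=> -[s1 s2]; split=> //; [exact: (reduce_by_span _ s2).1 | exact: (reduce_by_span _ s2).2].
Qed.

Lemma reduce_by_val g h : (absz (f h) <= absz (f g))%N ->
  absz (f (reduce_by g h)) = (absz (f g) - absz (f h))%N.
Proof.
rewrite /reduce_by /zsub /zadd.
by case: ifP; rewrite fB functionalD; move: (f g) (f h) => a b; lia.
Qed.

Lemma euclid_step_val p : let q := euclid_step p in
  (absz (f q.1) + absz (f q.2) < absz (f p.1) + absz (f p.2))%N \/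
  (absz (f q.1) = 0%N \/ absz (f q.2) = 0%N).
Proof.
rewrite /euclid_step; case: (ltnP (absz (f p.1)) _) => /= [lt|le]; rewrite reduce_by_val //; lia.
Qed.

Lemma euclid_step0 p : (absz (f p.1) = 0%N \/ absz (f p.2) = 0%N) ->
  let q := euclid_step p in (absz (f q.1) = 0%N \/ absz (f q.2) = 0%N).
Proof.
by rewrite /euclid_step; case: (ltnP (absz (f p.1)) _) => /= [lt|le]; rewrite reduce_by_val //; lia.
Qed.

Lemma euclid_pair_span p : same_pair p (euclid_pair p).
Proof.
move=> hs; rewrite /euclid_pair; set n := addn _ _; set q := iter _ _ _.
have -> : zspan hs p.1 /\ zspan hs p.2 <-> zspan hs q.1 /\ zspan hs q.2.
  rewrite /q; elim: n {q} => //= n ->; exact: euclid_step_span.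
by case: absz => //=; split=> -[].
Qed.

Lemma euclid_iter0 n p : (absz (f p.1) + absz (f p.2) <= n)%N ->
  let q := iter n euclid_step p in (absz (f q.1) = 0%N \/ absz (f q.2) = 0%N).
Proof.
elim: n p => [|n IHn] p; first by move=> /=; lia.
have zero k r : (absz (f r.1) = 0%N \/ absz (f r.2) = 0%N) ->
    (absz (f (iter k euclid_step r).1) = 0%N \/
     absz (f (iter k euclid_step r).2) = 0%N).
  by move=> H; elim: k => //= k; apply: euclid_step0.
rewrite iterSr => le; case: (euclid_step_val p) => [lt|]; last exact: zero.
by apply: IHn; lia.
Qed.

Lemma euclid_pair2 p : f (euclid_pair p).2 = 0.
Proof.
have := @euclid_iter0 _ p (leqnn _); rewrite /euclid_pair; case: (iter _ _ _) => x y /=.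
by case E : (absz (f x)) => [|k] /=; lia.
Qed.

Lemma euclidP gs : let e := euclid gs in
  (forall x, zspan (e.1 :: e.2) x <-> zspan gs x) /\
  (forall k, k \in e.2 -> f k = 0).
Proof.
elim: gs => [|g gs [IHs IH0]] /=.
  split=> // x; split; last by move=> sx; apply: sub_zspan sx.
  by apply: sub_zspan => y; rewrite inE => /eqP->; apply: zspan0.
set e := euclid gs in IHs IH0 *; set q := euclid_pair _.
have sq : same_pair (g, e.1) q by apply: euclid_pair_span.
split=> [x|k]; last first.
  by rewrite inE => /predU1P[->|/IH0//]; apply: euclid_pair2.
have s1 : zspan (q.1 :: q.2 :: e.2) g /\ zspan (q.1 :: q.2 :: e.2) e.1.
  by apply/(sq _); split; apply: zspan_mem; rewrite !inE eqxx ?orbT.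
have s2 : zspan (g :: gs) q.1 /\ zspan (g :: gs) q.2.
  apply/(sq _); split; first by apply: zspan_mem; rewrite inE eqxx.
  have : zspan gs e.1 by apply: (IHs _).1; apply: zspan_mem; rewrite inE eqxx.
  by apply: sub_zspan => y yg; apply: zspan_mem; rewrite inE yg orbT.
split; apply: sub_zspan => y.
  rewrite !inE => /or3P[/eqP->|/eqP->|ye]; [exact: s2.1 | exact: s2.2 |].
  have : zspan gs y by apply: (IHs _).1; apply: zspan_mem; rewrite inE ye orbT.
  by apply: sub_zspan => z zg; apply: zspan_mem; rewrite inE zg orbT.
rewrite inE => /predU1P[->|yg]; first exact: s1.1.
have : zspan (e.1 :: e.2) y by apply: (IHs _).2; apply: zspan_mem.
apply: sub_zspan => z; rewrite inE => /predU1P[->|ze]; first exact: s1.2.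
by apply: zspan_mem; rewrite !inE ze !orbT.
Qed.

Lemma zspan_fun0 gs x : (forall k, k \in gs -> f k = 0) -> zspan gs x -> f x = 0.
Proof.
move=> g0 sx; apply: (sx (fun x => f x = 0)) => // y z y0 z0.
by rewrite fB y0 z0 subrr.
Qed.

(** After the Euclidean algorithm f is nonzero on at most one generator; if an element
of the span is in the kernel of f, the coefficient of that generator is zero. *)
Lemma kernelP gs x : zspan (kernel gs) x <-> zspan gs x /\ f x = 0.
Proof.
have [es e0] := euclidP gs; rewrite /kernel; set e := euclid gs in es e0 *.
case E : (absz (f e.1)) => [|n].
  split=> [sx|[sx fx]]; last exact: (es _).2.
  split; first exact: (es _).1.
  apply: zspan_fun0 sx => k; rewrite inE => /predU1P[->|/e0//]; lia.
split=> [sx|[/(es _).2/zspan_cons[k sx] fx0]].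
  split; last exact: zspan_fun0 sx.
  by apply: (es _).1; apply: sub_zspan sx => y ye; apply: zspan_mem; rewrite inE ye orbT.
suff k0 : k = 0 by rewrite k0 mulr0z subr0 in sx.
have := zspan_fun0 e0 sx; rewrite fB functionalMz fx0; nia.
Qed.

(** The value of f on the surviving generator generates the image of f; the
vector sought exists exactly when this value is 1 or -1. *)
Definition unit_vector gs : option V :=
  let e := euclid gs in
  if absz (f e.1) is 1%N then Some (if absz (int_add (f e.1) (Posz 1)) is 0%N then zsub zzero e.1 else e.1)
  else None.

Lemma unit_vector_some gs x : unit_vector gs = Some x -> zspan gs x /\ f x = 1.
Proof.
have [es _] := euclidP gs; rewrite /unit_vector; set e := euclid gs in es *.
have se : zspan gs e.1 by apply: (es _).1; apply: zspan_mem; rewrite inE eqxx.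
case E : (absz (f e.1)) => [|[|n]] // [<-].
case F : (absz (int_add (f e.1) (Posz 1))) => [|n]; rewrite /zsub /zzero ?sub0r ?functionalN /int_add in F *; split; try by lia.
  exact: zspanN.
exact: se.
Qed.

Lemma unit_vector_none gs x : unit_vector gs = None -> zspan gs x -> f x <> 1.
Proof.
have [es e0] := euclidP gs; rewrite /unit_vector; set e := euclid gs in es e0 *.
move=> E /(es _).2/zspan_cons[k sx] fx1; have := zspan_fun0 e0 sx.
rewrite fB functionalMz fx1 => /eqP; rewrite subr_eq0 => /eqP /(congr1 absz) /esym/eqP.
by rewrite abszM muln_eq1 => /andP[/eqP E1 _]; rewrite E1 in E.
Qed.

End Euclid.

Section ComputableEuclid.
Context {V : zmodType} {cV : coded V}.
Hypothesis cadd : computable (fun p : V * V => zadd p.1 p.2).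
Hypothesis csub : computable (fun p : V * V => zsub p.1 p.2).

Lemma computable_reduce_by `{coded E} (f : E -> V -> int) (g h : E -> V) :
  computable (fun p : E * V => f p.1 p.2) -> computable g -> computable h ->
  computable (fun x => reduce_by (f x) (g x) (h x)).
Proof. by move=> cf cg ch; rewrite /reduce_by; computability. Qed.
#[local] Hint Resolve computable_reduce_by : computability.

Lemma computable_euclid_step `{coded E} (f : E -> V -> int) (p : E -> V * V) :
  computable (fun p : E * V => f p.1 p.2) -> computable p ->
  computable (fun x => euclid_step (f x) (p x)).
Proof. by move=> cf cp; rewrite /euclid_step; computability. Qed.
#[local] Hint Resolve computable_euclid_step : computability.

Lemma computable_euclid_pair `{coded E} (f : E -> V -> int) (p : E -> V * V) :
  computable (fun p : E * V => f p.1 p.2) -> computable p ->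
  computable (fun x => euclid_pair (f x) (p x)).
Proof. by move=> cf cp; rewrite /euclid_pair; computability. Qed.
#[local] Hint Resolve computable_euclid_pair : computability.

Lemma computable_euclid `{coded E} (f : E -> V -> int) (gs : E -> seq V) :
  computable (fun p : E * V => f p.1 p.2) -> computable gs ->
  computable (fun x => euclid (f x) (gs x)).
Proof. by move=> cf cg; rewrite /euclid; computability. Qed.
#[local] Hint Resolve computable_euclid : computability.

Lemma computable_kernel `{coded E} (f : E -> V -> int) (gs : E -> seq V) :
  computable (fun p : E * V => f p.1 p.2) -> computable gs ->
  computable (fun x => kernel (f x) (gs x)).
Proof. by move=> cf cg; rewrite /kernel; computability. Qed.

Lemma computable_unit_vector `{coded E} (f : E -> V -> int) (gs : E -> seq V) :
  computable (fun p : E * V => f p.1 p.2) -> computable gs ->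
  computable (fun x => unit_vector (f x) (gs x)).
Proof.
move=> cf cg; rewrite /unit_vector.
computability.
Qed.

End ComputableEuclid.
#[export] Hint Resolve computable_kernel computable_unit_vector : computability.

Local Close Scope ring_scope.
(** * Integer vectors and intersections of cosets *)

Local Open Scope ring_scope.

Definition vec (m : nat) := {ffun 'I_m -> int}.
HB.instance Definition _ m := GRing.Zmodule.on (vec m).

Section Vectors.
Variable m : nat.
Implicit Types (u v : vec m) (s : seq int).

Definition vec_seq v : seq int := [seq v i | i <- enum 'I_m].
Definition vec_of_seq s : vec m := [ffun i : 'I_m => nth (Posz 0) s i].

Definition coord (j : nat) v : int := nth (Posz 0) (vec_seq v) j.
Definition vec_add u v : vec m := u + v.
Definition vec_sub u v : vec m := u - v.
Definition vec0 : vec m := 0.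

Lemma coord_ord v (i : 'I_m) : coord i v = v i.
Proof. by rewrite /coord (nth_map i) ?size_enum_ord // nth_ord_enum. Qed.

Lemma coord_out j v : (m <= j)%N -> coord j v = 0.
Proof. by move=> le; rewrite /coord nth_default // size_map size_enum_ord. Qed.

Lemma coordB j u v : coord j (u - v) = coord j u - coord j v.
Proof.
case: (ltnP j m) => [lt|le]; last by rewrite !coord_out.
by rewrite -[j]/(nat_of_ord (Ordinal lt)) !coord_ord !ffunE.
Qed.

Lemma coord_inj u v : (forall j, (j < m)%N -> coord j u = coord j v) -> u = v.
Proof. by move=> uv; apply/ffunP => i; rewrite -!coord_ord uv. Qed.

Lemma vec_seqK v : vec_of_seq (vec_seq v) = v.
Proof. by apply/ffunP => i; rewrite ffunE -[LHS]/(coord i v) coord_ord. Qed.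

Lemma vec_of_seqK s : vec_seq (vec_of_seq s) = [seq nth (Posz 0) s j | j <- iota 0 m].
Proof.
rewrite -val_enum_ord -map_comp; apply: eq_map => i; exact: ffunE.
Qed.

End Vectors.

#[export] Instance coded_vec m : coded (vec m) := fun v => code (vec_seq v).

#[export] Instance injective_code_vec m : injective_code (vec m).
Proof.
move=> u v uv; rewrite -[u]vec_seqK -[v]vec_seqK; congr vec_of_seq.
exact: (@code_inj (seq int)) uv.
Qed.

Section ComputableVectors.
Variable m : nat.

Lemma computable_vec_seq (E : Type) (cE : coded E) (v : E -> vec m) :
  computable v -> computable (fun x => vec_seq (v x)).
Proof. exact: computable_code. Qed.

Lemma computable_vec_of_seq (E : Type) (cE : coded E) (s : E -> seq int) :
  computable s -> computable (fun x => vec_of_seq m (s x)).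
Proof.
move=> cs.
apply: (@computable_code _ _ _ _ _ _ _ (fun x => [seq nth (Posz 0) (s x) j | j <- iota 0 m])).
  by move=> x; rewrite -vec_of_seqK.
computability.
Qed.
#[local] Hint Resolve computable_vec_seq computable_vec_of_seq : computability.

Lemma computable_coord (E : Type) (cE : coded E) (j : E -> nat) (v : E -> vec m) :
  computable j -> computable v -> computable (fun x => coord (j x) (v x)).
Proof. by move=> cj cv; rewrite /coord; computability. Qed.
#[local] Hint Resolve computable_coord : computability.

Lemma computable_vec_add (E : Type) (cE : coded E) (u v : E -> vec m) :
  computable u -> computable v -> computable (fun x => vec_add (u x) (v x)).
Proof.
move=> cu cv.
apply: (@computable_ext _ _ _ _ _ (fun x => vec_of_seq m
  [seq int_add (coord j (u x)) (coord j (v x)) | j <- iota 0 m])).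
  move=> x; apply/ffunP => i;
  by rewrite !ffunE (nth_map 0%N) ?size_iota // nth_iota // add0n !coord_ord.
computability.
Qed.

Lemma computable_vec_sub (E : Type) (cE : coded E) (u v : E -> vec m) :
  computable u -> computable v -> computable (fun x => vec_sub (u x) (v x)).
Proof.
move=> cu cv.
apply: (@computable_ext _ _ _ _ _ (fun x => vec_of_seq m
  [seq int_add (coord j (u x)) (int_opp (coord j (v x))) | j <- iota 0 m])).
  move=> x; apply/ffunP => i;
  by rewrite !ffunE (nth_map 0%N) ?size_iota // nth_iota // add0n !coord_ord.
computability.
Qed.

End ComputableVectors.
#[export] Hint Resolve computable_vec_of_seq computable_coord computable_vec_add
  computable_vec_sub : computability.

Notation triple m := (int * vec m * vec m)%type.

Section Meet.
Variable m : nat.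
Implicit Types (ls : seq (vec m)) (w : triple m) (ws : seq (triple m)) (a c : vec m).

Definition middle_kernel ws : seq (triple m) :=
  foldl (fun hs j => kernel (fun w : triple m => coord j w.1.2) hs) ws (iota 0 m).

(** In a triple (tag, d, c), d is a quantity to be annihilated and c the result. An
element of the span of [diag ls1 ls2] is (0, l1 + l2, l1) with li in the span of
lsi; it has d = 0 exactly when c = l1 = - l2 is in both spans. *)
Definition diag ls1 ls2 : seq (triple m) :=
  [seq (Posz 0, l, l) | l <- ls1] ++ [seq (Posz 0, l, vec0 m) | l <- ls2].

Definition meet ls1 ls2 : seq (vec m) :=
  [seq w.2 | w : triple m <- middle_kernel (diag ls1 ls2)].

(** The additional generator (1, a1 - a2, a1) makes the triples of tag 1 the
(1, (a1 + l1) - (a2 - l2), a1 + l1): those with d = 0 give the common elements of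
the two cosets. *)
Definition coset_meet ls1 ls2 a1 a2 : option (vec m) :=
  if unit_vector (fun w : triple m => w.1.1)
       (middle_kernel ((Posz 1, vec_sub a1 a2, a1) :: diag ls1 ls2)) is Some w
  then Some w.2 else None.

Lemma middle_kernelP ws w :
  zspan (middle_kernel ws) w <-> zspan ws w /\ w.1.2 = 0.
Proof.
rewrite /middle_kernel; have -> : w.1.2 = 0 <->
    (forall j, j \in iota 0 m -> coord j w.1.2 = 0).
  have coord0 j : coord j (0 : vec m) = 0 by rewrite -(subrr 0) coordB subrr.
  split=> [-> //|w0]; apply: coord_inj => j lt.
  by rewrite coord0; apply: w0; rewrite mem_iota.
elim: (iota 0 m) ws => [|j js IHj] ws /=; first by split=> // -[].
rewrite IHj kernelP; last by move=> x y; apply: coordB.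
split=> [[[sw w0] ws0]|[sw ws0]].
  by split=> // k; rewrite inE => /predU1P[->|/ws0].
split=> [|k kj]; last by apply: ws0; rewrite inE kj orbT.
by split=> //; apply: ws0; rewrite inE eqxx.
Qed.

(** Each l1 and l2 can be recovered from d and c. *)
Lemma diagP ls1 ls2 w : zspan (diag ls1 ls2) w <->
  [/\ w.1.1 = 0, zspan ls1 w.2 & zspan ls2 (w.1.2 - w.2)].
Proof.
split=> [sw|[w0 s1 s2]].
  apply: (sw (fun w => [/\ w.1.1 = 0, zspan ls1 w.2 & zspan ls2 (w.1.2 - w.2)])).
  - by split=> //=; rewrite ?subrr; apply: zspan0.
  - move=> [[x0 x1] x2] [[y0 y1] y2] /= [-> sx tx] [-> sy ty]; split=> //.
      exact: zspanB.
    by rewrite subrACA; apply: zspanB.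
  - move=> g; rewrite mem_cat => /orP[]/mapP[l ll ->] /=; split=> //.
    + exact: zspan_mem.
    + by rewrite subrr; apply: zspan0.
    + by rewrite /vec0 subr0; apply: zspan_mem.
have -> : w = (0, w.2, w.2) + (0, w.1.2 - w.2, 0).
  case: w w0 {s1 s2} => -[x y] z /= ->.
  by congr (_, _, _); rewrite /= ?addr0 // addrC subrK.
apply: zspanD.
  have phiB y z : (0, y - z, y - z) = (0, y, y) - (0, z, z) :> triple m.
    by congr (_, _, _); rewrite subrr.
  apply: sub_zspan (zspan_image phiB s1) => g gl.
  by apply: zspan_mem; rewrite mem_cat gl.
have phiB y z : (0, y - z, 0) = (0, y, 0) - (0, z, 0) :> triple m.
  by congr (_, _, _); rewrite subrr.
apply: sub_zspan (zspan_image phiB s2) => g gl.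
by apply: zspan_mem; rewrite mem_cat gl orbT.
Qed.

Lemma meetP ls1 ls2 c : zspan (meet ls1 ls2) c <-> zspan ls1 c /\ zspan ls2 c.
Proof.
split=> [sc|[s1 s2]].
  apply: (sc (fun c => zspan ls1 c /\ zspan ls2 c)).
  - by split; apply: zspan0.
  - by move=> x y [? ?] [? ?]; split; apply: zspanB.
  - move=> g /mapP[w /zspan_mem/middle_kernelP[/diagP[_ s1 s2] w0] ->]; split=> //.
    by rewrite -[w.2]opprK -[- w.2]sub0r -w0; apply: zspanN.
have sw : zspan (middle_kernel (diag ls1 ls2)) (0, 0, c).
  by apply/middle_kernelP; split=> //; apply/diagP; split=> //=; rewrite sub0r; apply: zspanN.
exact: (zspan_image (phi := fun w : triple m => w.2)) sw.
Qed.

(** The tag counts the occurrences of the additional generator, so that it occurs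
exactly once here. *)
Lemma coset_meet_spanP ls1 ls2 a1 a2 c :
  zspan (middle_kernel ((Posz 1, vec_sub a1 a2, a1) :: diag ls1 ls2)) (Posz 1, 0, c)
  <-> zspan ls1 (c - a1) /\ zspan ls2 (c - a2).
Proof.
set g := (_, _, _); have -> : zspan ls1 (c - a1) /\ zspan ls2 (c - a2) <->
    zspan (diag ls1 ls2) ((Posz 1, 0, c) - g).
  have e : 0 - (a1 - a2) - (c - a1) = - (c - a2).
    by rewrite sub0r !opprB addrA subrK.
  rewrite diagP /= /vec_sub e; split=> [[s1 s2]|[_ s1 s2]].
    by split=> //; apply: zspanN.
  by split=> //; rewrite -[_ - _]opprK; apply: zspanN.
rewrite middle_kernelP /=; split=> [[/zspan_cons[n sn] _]|sn].
  have [+ _ _] := (diagP _ _ _).1 sn; rewrite /= => n1.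
  suff n_1 : n = 1 by rewrite n_1 mulr1z in sn.
  have : (g *~ n).1.1 = n.
    have nat_case k : (g *+ k).1.1 = k%:Z.
      by elim: k => // k IHk; rewrite mulrS /= IHk; lia.
    by case: n {sn n1} => k; rewrite ?NegzE ?mulrNz -pmulrn /= nat_case.
  by move: n1 => /=; lia.
split=> //; rewrite -[X in zspan _ X](subrK g); apply: zspanD.
  by apply: sub_zspan sn => w ww; apply: zspan_mem; rewrite inE ww orbT.
by apply: zspan_mem; rewrite inE eqxx.
Qed.

Lemma coset_meet_some ls1 ls2 a1 a2 c : coset_meet ls1 ls2 a1 a2 = Some c ->
  zspan ls1 (c - a1) /\ zspan ls2 (c - a2).
Proof.
rewrite /coset_meet; case E : unit_vector => [[[x y] z]|] // [<-].
have [//|sw /= x1] := unit_vector_some _ E; rewrite {E}x1 in sw.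
have [_ /= y0] := (middle_kernelP _ _).1 sw; rewrite {}y0 in sw.
exact/coset_meet_spanP.
Qed.

Lemma coset_meet_none ls1 ls2 a1 a2 c : coset_meet ls1 ls2 a1 a2 = None ->
  zspan ls1 (c - a1) -> ~ zspan ls2 (c - a2).
Proof.
rewrite /coset_meet; case E : unit_vector => [//|] _ s1 s2.
have /coset_meet_spanP sw := conj s1 s2.
by apply: (unit_vector_none _ E sw).
Qed.

Lemma computable_zadd_triple : computable (fun p : triple m * triple m => zadd p.1 p.2).
Proof.
have c : computable (fun p : triple m * triple m =>
  (int_add p.1.1.1 p.2.1.1, vec_add p.1.1.2 p.2.1.2, vec_add p.1.2 p.2.2) : triple m).
  computability.
exact: (computable_ext _ c).
Qed.

Lemma computable_zsub_triple : computable (fun p : triple m * triple m => zsub p.1 p.2).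
Proof.
have c : computable (fun p : triple m * triple m =>
  (int_add p.1.1.1 (int_opp p.2.1.1), vec_sub p.1.1.2 p.2.1.2, vec_sub p.1.2 p.2.2) : triple m).
  computability.
exact: (computable_ext _ c).
Qed.

Lemma computable_middle_kernel (E : Type) (cE : coded E) (ws : E -> seq (triple m)) :
  computable ws -> computable (fun x => middle_kernel (ws x)).
Proof.
move=> cw; rewrite /middle_kernel.
have cf : computable (fun p : (E * (seq (triple m) * nat)) * triple m =>
    coord p.1.2.2 p.2.1.2) by computability.
have cs : computable (fun p : E * (seq (triple m) * nat) => p.2.1) by computability.
apply: computable_foldl; try computability.
exact: (computable_kernel computable_zadd_triple computable_zsub_triple
  (f := fun p w => coord p.2.2 w.1.2) cf cs).
Qed.
#[local] Hint Resolve computable_middle_kernel : computability.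

Lemma computable_meet (E : Type) (cE : coded E) (ls1 ls2 : E -> seq (vec m)) :
  computable ls1 -> computable ls2 -> computable (fun x => meet (ls1 x) (ls2 x)).
Proof. by move=> c1 c2; rewrite /meet /diag; computability. Qed.

Lemma computable_coset_meet (E : Type) (cE : coded E) (ls1 ls2 : E -> seq (vec m))
    (a1 a2 : E -> vec m) :
  computable ls1 -> computable ls2 -> computable a1 -> computable a2 ->
  computable (fun x => coset_meet (ls1 x) (ls2 x) (a1 x) (a2 x)).
Proof.
move=> c1 c2 ca1 ca2; rewrite /coset_meet /diag.
have cf : computable (fun p : E * triple m => p.2.1.1) by computability.
have cg : computable (fun x => middle_kernel ((Posz 1, vec_sub (a1 x) (a2 x), a1 x)
    :: ([seq (Posz 0, l, l) | l <- ls1 x] ++ [seq (Posz 0, l, vec0 m) | l <- ls2 x]))).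
  by computability.
have cu := computable_unit_vector computable_zadd_triple computable_zsub_triple
  (f := fun _ w => w.1.1) cf cg.
have c3 : computable (fun p : E * triple m => Some p.2.2) by computability.
have c4 : computable (fun _ : E => None : option (vec m)) by computability.
exact: (computable_option cu c3 c4).
Qed.

End Meet.
#[export] Hint Resolve computable_meet computable_coset_meet : computability.

Local Close Scope ring_scope.
(** * Labelled automata of finitely generated subgroups *)

Local Open Scope group_scope.

Section Generated.
Variable G : groupType.
Implicit Types (S H : set G) (x y : G).

Lemma subgroupV H x : is_subgroup H -> H x -> H x^-1.
Proof. by move=> [H1 HB] Hx; rewrite -[x^-1]mul1g; apply: HB. Qed.

Lemma subgroupM H x y : is_subgroup H -> H x -> H y -> H (x * y).
Proof.
by move=> sH Hx Hy; rewrite -[y]invgK; apply: sH.2 => //; apply: subgroupV.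
Qed.

Lemma generated_min S H : is_subgroup H -> S `<=` H -> generated S `<=` H.
Proof. by move=> sH SH x; apply. Qed.

Lemma generated_mem S : S `<=` generated S.
Proof. by move=> x Sx H [_]; apply. Qed.

Lemma generated_subgroup S : is_subgroup (generated S).
Proof.
split=> [H [[]]//|x y gx gy H HS]; have [sH _] := HS.
by apply: sH.2; [apply: gx | apply: gy].
Qed.

End Generated.

Section Words.
Variable X : finType.
Implicit Types (u v w : word X) (l : letter X).

Lemma fg_of_wordE u v : (fg_of_word u = fg_of_word v) <-> (reduce u = reduce v).
Proof. by split=> [[]//|uv]; apply: val_inj. Qed.

Lemma fg_of_word_reduce u : fg_of_word (reduce u) = fg_of_word u.
Proof. by apply/fg_of_wordE; rewrite reduce_id // reduced_reduce. Qed.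

Lemma fgvalK (g : freegroup X) : fg_of_word (fgval g) = g.
Proof. by case: g => u ru; apply: val_inj; rewrite /= reduce_id. Qed.

Lemma fg_of_word_cat u v : fg_of_word (u ++ v) = fg_of_word u * fg_of_word v.
Proof. by apply: val_inj; rewrite /= reduce_catl reduce_catr. Qed.

Lemma fg_of_word_nil : fg_of_word [::] = 1 :> freegroup X.
Proof. by []. Qed.

Lemma fg_of_word_inv u : fg_of_word (inv_word u) = (fg_of_word u)^-1.
Proof.
have uV : fg_of_word u * fg_of_word (inv_word u) = 1.
  by rewrite -fg_of_word_cat; apply: val_inj; rewrite /= reduce_mul_inv.
by rewrite -[LHS](mulKg (fg_of_word u)) uV mulg1.
Qed.

Lemma inv_word_cat u v : inv_word (u ++ v) = inv_word v ++ inv_word u.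
Proof. by rewrite /inv_word map_cat rev_cat. Qed.

Lemma inv_word_cons l u : inv_word (l :: u) = rcons (inv_word u) (linv l).
Proof. by rewrite /inv_word /= rev_cons. Qed.

Lemma inv_word_rcons u l : inv_word (rcons u l) = linv l :: inv_word u.
Proof. by rewrite -cats1 inv_word_cat. Qed.

Lemma fg_of_letterV l : fg_of_word [:: linv l] = (fg_of_word [:: l])^-1.
Proof. by rewrite -fg_of_word_inv. Qed.

Lemma reduced_inv_word u : reduced_word u -> reduced_word (inv_word u).
Proof.
rewrite /reduced_word /inv_word rev_sorted sorted_map; apply: sub_sorted => a b /=.
by apply: contra => /eqP ->; rewrite linvK.
Qed.

End Words.

Lemma computable_linv (X : finType) (E : Type) (cE : coded E) (l : E -> letter X) :
  computable l -> computable (fun x => linv (l x)).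
Proof. by move=> cl; rewrite /linv; computability. Qed.
#[export] Hint Resolve computable_linv : computability.

Lemma computable_inv_word (X : finType) (E : Type) (cE : coded E) (w : E -> word X) :
  computable w -> computable (fun x => inv_word (w x)).
Proof. by move=> cw; rewrite /inv_word; computability. Qed.

Lemma computable_reduce (X : finType) (E : Type) (cE : coded E) (w : E -> word X) :
  computable w -> computable (fun x => reduce (w x)).
Proof.
move=> cw; rewrite /reduce; apply: (@computable_ext _ _ _ _ _ (fun x =>
  foldr (fun (a : letter X) (w : word X) => if w is b :: w' then
    if same_code b (linv a) then w' else a :: w else [:: a]) [::] (w x))).
  move=> x; elim: (w x) => //= a v ->; rewrite /push.
  by case: foldr => // b v'; rewrite same_codeE.
computability.
Qed.
#[export] Hint Resolve computable_inv_word computable_reduce : computability.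

Section Machine.
Variables (X : finType) (m : nat).
Implicit Types (u v w p q : word X) (l : letter X) (a c : vec m).

Notation elt := (word X * vec m)%type.
Notation arcd := ((word X * letter X) * (word X * vec m))%type.
Notation FV := (FxA X (vec m)).
Implicit Types (S : seq elt) (E : seq arcd) (s t : word X * vec m).

Definition elt_val (x : elt) : FV := (fg_of_word x.1, x.2).
Definition span_elts S : set FV := generated [set elt_val x | x in [set` S]].

Lemma span_elts_mem S x : x \in S -> span_elts S (elt_val x).
Proof. by move=> xS; apply: generated_mem; exists x. Qed.

Definition elt_div (x y : elt) : elt :=
  (reduce (x.1 ++ inv_word y.1), vec_sub x.2 y.2).

Lemma elt_val_div x y : elt_val (elt_div x y) = elt_val x / elt_val y.
Proof.
by congr (_, _); rewrite /= fg_of_word_reduce fg_of_word_cat fg_of_word_inv.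
Qed.

(** Iterated quotients exhaust the subgroup: the list at rank n + 1 contains x / y for
all x and y of the list at rank n. *)
Definition products S n : seq elt :=
  iter n (fun L => L ++ flatten [seq [seq elt_div x y | y <- L] | x <- L])
    (([::], vec0 m) :: [seq (reduce x.1, x.2) | x <- S]).

Lemma products_sound S n x : x \in products S n -> span_elts S (elt_val x).
Proof.
have sG := generated_subgroup [set elt_val x | x in [set` S]].
elim: n x => [|n IHn] x /=.
  rewrite inE => /predU1P[->|/mapP[y yS ->]]; first exact: sG.1.
  by rewrite /elt_val /= fg_of_word_reduce; apply: span_elts_mem.
rewrite mem_cat => /orP[/IHn//|/flatten_mapP[y yL] /mapP[z zL ->]].
by rewrite elt_val_div; apply: sG.2; apply: IHn.
Qed.

Lemma products_mono S n k x : n <= k -> x \in products S n -> x \in products S k.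
Proof.
move=> /subnK <-; elim: (k - n) => //= i IHi /IHi xi.
by rewrite mem_cat xi.
Qed.

Lemma products_complete S (g : FV) : span_elts S g ->
  exists n, (fgval g.1, g.2) \in products S n.
Proof.
apply: (generated_min (H := [set g : FV | exists n, (fgval g.1, g.2) \in products S n])).
  split=> [|x y [n xn] [k yk]]; first by exists 0%N; rewrite inE eqxx.
  exists (maxn n k).+1.
  rewrite /= mem_cat; apply/orP; right; apply/flatten_mapP.
  exists (fgval x.1, x.2); first exact: products_mono (leq_maxl _ _) xn.
  apply/mapP; exists (fgval y.1, y.2); first exact: products_mono (leq_maxr _ _) yk.
  by congr (_, _); rewrite /= reduce_catr.
move=> _ [x xS <-]; exists 0%N; rewrite inE; apply/orP; right.
by apply/mapP; exists x.
Qed.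

(** A machine is a list of arcs ((p, l), (q, a)) from p to q, with label l and vector
a; vertices are words, and the base is the empty word. *)
Definition machine_lookup E p l : option (word X * vec m) :=
  if [seq e.2 | e <- [seq e <- E | same_code e.1 (p, l)]] is t :: _ then Some t else None.

Lemma lookup_some E p l t : machine_lookup E p l = Some t -> ((p, l), t) \in E.
Proof.
rewrite /machine_lookup; elim: E => //= -[pl t'] E IHE; rewrite same_codeE /=; case: eqP => /= [->|_].
  by case=> ->; rewrite inE eqxx.
by move/IHE; rewrite inE orbC => ->.
Qed.

Definition machine_step E (st : option (word X * vec m)) l : option (word X * vec m) :=
  if st is Some s then
    if machine_lookup E s.1 l is Some t then Some (t.1, vec_add s.2 t.2) else None
  else None.

Definition machine_run E st w : option (word X * vec m) := foldl (machine_step E) st w.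
Definition machine_read E w := machine_run E (Some ([::], vec0 m)) w.

Lemma run_None E w : machine_run E None w = None.
Proof. by elim: w. Qed.

Lemma run_cons E st l w : machine_run E st (l :: w) = machine_run E (machine_step E st l) w.
Proof. by []. Qed.

Lemma run_cat E st u v : machine_run E st (u ++ v) = machine_run E (machine_run E st u) v.
Proof. exact: foldl_cat. Qed.

Lemma run_shift E p a w q b c : machine_run E (Some (p, a)) w = Some (q, b) ->
  machine_run E (Some (p, a + c)%R) w = Some (q, b + c)%R.
Proof.
elim: w p a => [|l w IHw] p a /=; first by case=> -> ->.
rewrite /machine_run /=; case: machine_lookup => [t|]; rewrite -/(machine_run _ _ _) ?run_None //.
by move/IHw; rewrite /vec_add addrAC.
Qed.

Section Invertible.
Variable E : seq arcd.
Hypothesis Einv : forall p l q a, machine_lookup E p l = Some (q, a) ->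
  machine_lookup E q (linv l) = Some (p, - a)%R.

Lemma step_linv s l t : machine_step E (Some s) l = Some t ->
  machine_step E (Some t) (linv l) = Some s.
Proof.
rewrite /=; case e : machine_lookup => [[q a]|] // [<-] /=.
by rewrite (Einv e) /vec_add /= addrK; case: s {e}.
Qed.

Lemma run_inv s w t : machine_run E (Some s) w = Some t -> machine_run E (Some t) (inv_word w) = Some s.
Proof.
elim: w s => [|l w IHw] s; first by case=> ->.
rewrite inv_word_cons run_cons -cats1 run_cat.
case e : (machine_step E (Some s) l) => [r|]; rewrite ?run_None // => /IHw ->.
exact: step_linv e.
Qed.

(** Invertible arcs make it harmless to cancel l l^-1 in a word that can be read. *)
Lemma run_reduce s w t : machine_run E (Some s) w = Some t -> machine_run E (Some s) (reduce w) = Some t.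
Proof.
elim: w s => [|l w IHw] s //; rewrite run_cons [reduce _]/(push l (reduce w)).
case e : (machine_step E (Some s) l) => [r|]; rewrite ?run_None // => /IHw.
rewrite /push; case: (reduce w) => [|b v]; first by rewrite run_cons e.
case: eqP => [->|_] r_bv; last by rewrite run_cons e.
by move: r_bv; rewrite run_cons (step_linv e).
Qed.

End Invertible.

(** A finite certificate: arcs are invertible, and p l q^-1 t^a is a product of at
most 2^n generators and inverses for each arc, so that what is read from the base to
the base is in the subgroup; the generators are read back to the base, so that
conversely all of the subgroup is read, up to [abelian_part]. *)
Definition valid_machine S E n : bool :=
  all (fun e : arcd =>
    (if machine_lookup E e.2.1 (linv e.1.2) is Some t
     then same_code t (e.1.1, vec_sub (vec0 m) e.2.2) else false) &&
    has (fun x => same_code x (reduce (e.1.1 ++ e.1.2 :: inv_word e.2.1), e.2.2)) (products S n)) E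
  && all (fun x : elt => if machine_read E x.1 is Some s then same_code s.1 [::] else false) S.

(** The discrepancies between the vectors of the generators and the vectors read along
their words; they generate the intersection of the subgroup with V. *)
Definition abelian_part S E : seq (vec m) :=
  [seq vec_sub x.2 (if machine_read E x.1 is Some s then s.2 else vec0 m) | x : elt <- S].

Section Valid.
Variables (S : seq elt) (E : seq arcd) (n : nat).
Hypothesis validE : valid_machine S E n.

Let subgroupS : is_subgroup (span_elts S) := generated_subgroup _.

Lemma valid_inv p l q a : machine_lookup E p l = Some (q, a) ->
  machine_lookup E q (linv l) = Some (p, - a)%R.
Proof.
move/lookup_some => pE; have /andP[/allP arcs _] := validE.
have /andP[+ _] := arcs _ pE; rewrite /=.
case: machine_lookup => // t; rewrite same_codeE => /eqP ->.
by rewrite /vec_sub /vec0 sub0r.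
Qed.

Lemma valid_arc p l q a : machine_lookup E p l = Some (q, a) ->
  span_elts S (fg_of_word (p ++ l :: inv_word q), a).
Proof.
move/lookup_some => pE; have /andP[/allP arcs _] := validE.
have /andP[_ /hasP[x xn]] := arcs _ pE.
rewrite /= same_codeE => /eqP xE; have := products_sound xn.
by rewrite {}xE /elt_val /= fg_of_word_reduce.
Qed.

(** The names of the vertices are coset representatives: the inner ones cancel. *)
Lemma valid_run p a w q b : machine_run E (Some (p, a)) w = Some (q, b) ->
  span_elts S (fg_of_word (p ++ w ++ inv_word q), (b - a)%R).
Proof.
elim: w p a => [|l w IHw] p a.
  case=> <- <-; rewrite subrr fg_of_word_cat fg_of_word_inv mulgV.
  exact: subgroupS.1.
rewrite /machine_run /=; case e : machine_lookup => [[r c]|]; rewrite -/(machine_run _ _ _) ?run_None //.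
move/IHw => /=; have := valid_arc e => h1 h2.
have := subgroupM subgroupS h1 h2; congr (span_elts S _); congr (_, _).
  rewrite -[l :: inv_word r]cat1s -[l :: (w ++ _)]cat1s !(fg_of_word_cat, fg_of_word_inv).
  by rewrite !mulgA mulgVK.
change ((c + (b - vec_add a c))%R = (b - a)%R); rewrite /vec_add.
by rewrite opprD addrCA [(- a - c)%R]addrC [(c + _)%R]addrA subrr add0r.
Qed.

Lemma valid_read_sound w a : machine_read E w = Some ([::], a) ->
  span_elts S (fg_of_word w, a).
Proof. by move/valid_run; rewrite cats0 /= /vec0 subr0. Qed.

Lemma abelian_part_sound c : zspan (abelian_part S E) c -> span_elts S (1, c).
Proof.
move=> sc; apply: (sc (fun c => span_elts S (1, c))).
- exact: subgroupS.1.
- move=> y z sy sz; have := subgroupS.2 _ _ sy sz.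
  by congr (span_elts S _); congr (_, _); rewrite /= invg1 mulg1.
move=> _ /mapP[x xS ->]; have /andP[_ /allP/(_ _ xS)] := validE.
case e : (machine_read E x.1) => [[q a]|] //; rewrite same_codeE => /eqP /= qE; rewrite {}qE in e.
have := subgroupS.2 _ _ (span_elts_mem xS) (valid_read_sound e).
by congr (span_elts S _); congr (_, _); rewrite /= mulgV.
Qed.

(** The elements read up to [abelian_part] form a subgroup, because a walk can be
shifted, reversed and reduced; the generators belong to it by construction. *)
Lemma valid_read_complete (g : FV) : span_elts S g -> exists2 a,
  machine_read E (fgval g.1) = Some ([::], a) & zspan (abelian_part S E) (g.2 - a)%R.
Proof.
apply: (generated_min (H := [set g : FV | exists2 a,
  machine_read E (fgval g.1) = Some ([::], a) & zspan (abelian_part S E) (g.2 - a)%R])).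
  split=> [|x y [a xa sa] [b yb sb]].
    by exists (vec0 m) => //=; rewrite /vec0 subrr; apply: zspan0.
  exists (a - b)%R; last first.
    change (zspan (abelian_part S E) (((x.2 : vec m) - (y.2 : vec m)) - (a - b))%R).
    by rewrite subrACA; apply: zspanB.
  rewrite /machine_read; apply: run_reduce; first exact: valid_inv.
  rewrite run_cat -/(machine_read _ _) xa /=.
  apply: run_reduce; first exact: valid_inv.
  apply: run_inv; first exact: valid_inv.
  have := run_shift (a - b)%R yb; rewrite /vec0 add0r => ->.
  by rewrite addrC subrK.
move=> _ [x xS <-]; have /andP[_ /allP/(_ _ xS)] := validE.
case e : (machine_read E x.1) => [[q a]|] //; rewrite same_codeE => /eqP /= qE; rewrite {}qE in e.
exists a; first exact: (run_reduce valid_inv e).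
by apply: zspan_mem; apply/mapP; exists x => //; rewrite e.
Qed.

Lemma abelian_partP c : span_elts S (1, c) <-> zspan (abelian_part S E) c.
Proof.
split; last exact: abelian_part_sound.
by move/valid_read_complete => [a /=]; rewrite /machine_read /= => -[<-]; rewrite /vec0 subr0.
Qed.

End Valid.

End Machine.

Local Close Scope group_scope.
(** * Unbounded search *)

(** Membership is required from some rank on, so that the ranks of two enumerations can
be synchronized by taking a maximum. *)
Definition enumerates T (en : nat -> seq T) : Prop :=
  forall x, exists n, forall k, n <= k -> List.In x (en k).

Definition enumerable T {cT : coded T} : Prop :=
  exists en : nat -> seq T, computable en /\ enumerates en.
Arguments enumerable T {cT}.

Lemma in_flatten_map T U (f : T -> seq U) (s : seq T) x y :
  List.In y (f x) -> List.In x s -> List.In y (flatten [seq f z | z <- s]).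
Proof.
move=> yx; elim: s => //= z s IHs [->|/IHs ys]; apply/List.in_app_iff; first by left.
by right.
Qed.

Lemma enumerable_surj T U (cT : coded T) (cU : coded U) (g : T -> U) :
  computable g -> (forall y, exists x, g x = y) -> enumerable T -> enumerable U.
Proof.
move=> cg surj [en [cen enP]]; exists (fun n => map g (en n)); split.
  by computability.
move=> y; have [x <-] := surj y; have [n nP] := enP x.
by exists n => k nk; apply: List.in_map; apply: nP.
Qed.

Lemma enumerable_nat : enumerable nat.
Proof.
exists (fun n => iter n (fun s => 0 :: map S s) [::]); split; first by computability.
elim=> [|x [n nP]].
  by exists 1 => -[|k] // _; left.
by exists n.+1 => -[|k] // nk; right; apply: List.in_map; apply: nP.
Qed.

Lemma enumerable_fin (X : finType) (cX : coded X) : enumerable X.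
Proof.
exists (fun _ => enum X); split; first by computability.
by move=> x; exists 0 => k _; have := mem_enum X x; elim: (enum _) => //= y s IHs;
  rewrite inE => /predU1P[->|/IHs]; [left | right].
Qed.

Lemma enumerable_pair T U (cT : coded T) (cU : coded U) :
  enumerable T -> enumerable U -> enumerable (T * U)%type.
Proof.
move=> [en [cen enP]] [fn [cfn fnP]].
exists (fun n => flatten [seq [seq (x, y) | y <- fn n] | x <- en n]); split.
  by computability.
move=> [x y]; have [n nP] := enP x; have [k kP] := fnP y.
exists (maxn n k) => i; rewrite geq_max => /andP[ni ki].
by apply: (in_flatten_map _ (nP _ ni)); apply: List.in_map; apply: kP.
Qed.

Lemma enumerable_seq T (cT : coded T) : enumerable T -> enumerable (seq T).
Proof.
move=> [en [cen enP]].
pose next n (L : seq (seq T)) :=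
  [::] :: flatten [seq [seq x :: s | s <- L] | x <- en n].
exists (fun n => iter n (next n) [::]); split; first by rewrite /next; computability.
move=> s.
suff [n nP] : exists n, forall j k, n <= j -> n <= k -> List.In s (iter j (next k) [::]).
  by exists n => k nk; apply: nP.
elim: s => [|x s [n nP]].
  by exists 1 => -[|j] // k _ _; left.
have [i iP] := enP x.
exists (maxn n i).+1 => -[|j] // k; rewrite ltnS geq_max => /andP[nj ij] le.
right; apply: (in_flatten_map _ (iP _ _)); last by lia.
by apply: List.in_map; apply: nP => //; lia.
Qed.

Lemma enumerable_int : enumerable int.
Proof.
apply: (enumerable_surj (T := bool * nat) (g := fun p => if p.1 then Negz p.2 else Posz p.2)).
- by computability.
- by move=> [] n; [exists (false, n) | exists (true, n)].
- by apply: enumerable_pair enumerable_nat; apply: enumerable_fin.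
Qed.

Lemma enumerable_vec m : enumerable (vec m).
Proof.
apply: (enumerable_surj (T := seq int) (g := vec_of_seq m)).
- by apply: computable_vec_of_seq; computability.
- by move=> v; exists (vec_seq v); apply: vec_seqK.
- exact: enumerable_seq enumerable_int.
Qed.

Lemma enumerable_letter (X : finType) : enumerable (letter X).
Proof. by apply: enumerable_pair; apply: enumerable_fin. Qed.

Lemma enumerable_word (X : finType) : enumerable (word X).
Proof. exact: enumerable_seq (enumerable_letter X). Qed.

(** A correct value that is only known to exist can be computed: all the candidates are
enumerated until one passes the test. *)
Lemma computable_search E T (cE : coded E) (cT : coded T) (d : T)
    (c : E -> T -> bool) : enumerable T ->
  computable (fun p : E * T => c p.1 p.2) -> (forall x, exists y, c x y) ->
  exists2 f : E -> T, computable f & forall x, c x (f x).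
Proof.
move=> [en [cen enP]] cc ex.
have ex_n x : exists n, has (c x) (en n).
  have [y cxy] := ex x; have [n nP] := enP y; exists n.
  move: (nP n (leqnn n)); elim: (en n) => //= z s IHs [->|/IHs ->]; first by rewrite cxy.
  by rewrite orbT.
exists (fun x => head d [seq y <- en (ex_minn (ex_n x)) | c x y]).
  have cn : computable (fun x => ex_minn (ex_n x)).
    by apply: computable_ex_minn; computability.
  by computability.
move=> x; case: ex_minnP => n + _; elim: (en n) => //= y s IHs.
by case e : (c x y) => //=; apply: IHs.
Qed.

(** * Cosets, and existence of a correct automaton *)

Local Open Scope group_scope.

Section Cosets.
Variables (X : finType) (V : zmodType) (K : set (FxA X V)).
Hypothesis sK : is_subgroup K.
Implicit Types (u v w : word X) (l : letter X) (a b c : V).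

Definition proj w : Prop := exists c : V, K (fg_of_word w, c).
(** Equality of the right cosets of the projection. *)
Definition coset_eq u v : Prop := proj (u ++ inv_word v).

Lemma subgroup_pairM (g h : freegroup X) a b :
  K (g, a) -> K (h, b) -> K (g * h, (a + b)%R).
Proof. by move=> Ka Kb; exact: (subgroupM sK Ka Kb). Qed.

Lemma subgroup_pairV (g : freegroup X) a : K (g, a) -> K (g^-1, (- a)%R).
Proof. by move=> Ka; exact: (subgroupV sK Ka). Qed.

Lemma proj_fg u v : fg_of_word u = fg_of_word v -> proj u -> proj v.
Proof. by move=> uv [c]; rewrite uv => Kc; exists c. Qed.

Lemma proj_nil : proj [::].
Proof. by exists 0%R; apply: sK.1. Qed.

Lemma proj_cat u v : proj u -> proj v -> proj (u ++ v).
Proof.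
move=> [c Kc] [d Kd]; exists (c + d)%R; rewrite fg_of_word_cat.
exact: subgroup_pairM.
Qed.

Lemma proj_inv u : proj u -> proj (inv_word u).
Proof.
by move=> [c Kc]; exists (- c)%R; rewrite fg_of_word_inv; apply: subgroup_pairV.
Qed.

Lemma coset_eq_fg u v : fg_of_word u = fg_of_word v -> coset_eq u v.
Proof.
move=> uv; apply: (proj_fg (u := [::])) proj_nil.
by rewrite fg_of_word_cat fg_of_word_inv uv mulgV.
Qed.

Lemma coset_eq_refl u : coset_eq u u.
Proof. exact: coset_eq_fg. Qed.

Lemma coset_eq_sym u v : coset_eq u v -> coset_eq v u.
Proof.
by move=> /proj_inv; apply: proj_fg; rewrite inv_word_cat inv_wordK.
Qed.

Lemma coset_eq_trans v u w : coset_eq u v -> coset_eq v w -> coset_eq u w.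
Proof.
move=> uv vw; apply: proj_fg (proj_cat uv vw).
by rewrite !(fg_of_word_cat, fg_of_word_inv) mulgA mulgVK.
Qed.

Lemma coset_eq_cat w u v : coset_eq u v -> coset_eq (u ++ w) (v ++ w).
Proof.
apply: proj_fg; rewrite inv_word_cat !(fg_of_word_cat, fg_of_word_inv).
by rewrite !mulgA mulgK.
Qed.

Lemma coset_eq_rcons l u v : coset_eq u v -> coset_eq (rcons u l) (rcons v l).
Proof. by rewrite -!cats1; apply: coset_eq_cat. Qed.

Lemma coset_eq_rconsK l u v : coset_eq (rcons u l) (rcons v l) -> coset_eq u v.
Proof.
rewrite -!cats1; apply: proj_fg; rewrite inv_word_cat !(fg_of_word_cat, fg_of_word_inv).
by rewrite !mulgA mulgK.
Qed.

Lemma fg_rcons_linv u l : fg_of_word (rcons (rcons u l) (linv l)) = fg_of_word u.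
Proof. by rewrite -!cats1 !fg_of_word_cat fg_of_letterV mulgK. Qed.

Lemma coset_eq_linv u v l : coset_eq (rcons u l) v -> coset_eq u (rcons v (linv l)).
Proof.
move/(@coset_eq_rcons (linv l)); apply: coset_eq_trans.
by apply: coset_eq_fg; rewrite fg_rcons_linv.
Qed.

Lemma coset_eq_nil u : coset_eq u [::] <-> proj u.
Proof. by rewrite /coset_eq cats0. Qed.

(** A classical choice, constrained to name the projection itself by the empty word,
the base of a machine. *)
Definition class_rep u : word X :=
  if `[<coset_eq u [::]>] then [::] else choose (fun v => `[<coset_eq u v>]) u.

Lemma class_rep_eq u : coset_eq u (class_rep u).
Proof.
rewrite /class_rep; case: ifP => [/asboolP//|_].
have uu : `[<coset_eq u u>] by apply/asboolP; exact: coset_eq_refl.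
by apply/asboolP; exact: (@chooseP _ (fun v => `[<coset_eq u v>]) u uu).
Qed.

Lemma class_rep_inj u v : coset_eq u v -> class_rep u = class_rep v.
Proof.
move=> uv; have e w : `[<coset_eq u w>] = `[<coset_eq v w>].
  apply/asbool_equiv_eq; split; last exact: coset_eq_trans.
  by apply: coset_eq_trans; apply: coset_eq_sym.
rewrite /class_rep e; case: ifP => // _.
rewrite (eq_choose e); apply: choose_id; apply/asboolP; last exact: coset_eq_refl.
exact: coset_eq_sym.
Qed.

Lemma class_rep_id u : class_rep (class_rep u) = class_rep u.
Proof. by apply: class_rep_inj; apply: coset_eq_sym; apply: class_rep_eq. Qed.

Lemma class_rep_nil u : proj u -> class_rep u = [::].
Proof. by move=> /coset_eq_nil pu; rewrite /class_rep; case: asboolP. Qed.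

Lemma class_rep_rcons u l : class_rep (rcons (class_rep u) l) = class_rep (rcons u l).
Proof.
by apply: class_rep_inj; apply: coset_eq_rcons; apply: coset_eq_sym; apply: class_rep_eq.
Qed.

(** Vectors are chosen on positive letters only and transported to negative ones,
so that labels of opposite arcs are exactly opposite. *)
Lemma class_label : exists lab : word X -> letter X -> V,
  (forall p l, class_rep p = p ->
     K (fg_of_word (p ++ l :: inv_word (class_rep (rcons p l))), lab p l)) /\
  (forall p l, class_rep p = p ->
     lab (class_rep (rcons p l)) (linv l) = (- lab p l)%R).
Proof.
have ex (pl : word X * letter X) : exists c,
    K (fg_of_word (pl.1 ++ pl.2 :: inv_word (class_rep (rcons pl.1 pl.2))), c).
  by have := class_rep_eq (rcons pl.1 pl.2); rewrite /coset_eq /proj cat_rcons.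
have [f fP] := boolp.choice ex.
pose q p l := class_rep (rcons p l).
exists (fun p l => if positive l then f (p, l) else (- f (q p l, linv l))%R).
have qK p l : class_rep p = p -> q (q p l) (linv l) = p.
  move=> rp; rewrite -[RHS]rp /q class_rep_rcons; apply: class_rep_inj.
  by apply: coset_eq_fg; rewrite fg_rcons_linv.
split=> p l rp.
  case: ifP => _; first exact: (fP (p, l)).
  have /subgroup_pairV := fP (q p l, linv l); rewrite /= -/(q _ _) qK //.
  rewrite -fg_of_word_inv inv_word_cat inv_word_cons inv_wordK linvK cat_rcons.
  by rewrite -/(q _ _).
rewrite -/(q p l) qK // linvK /positive /=; case: (l) => x [] /=; by rewrite ?opprK.
Qed.

End Cosets.

Definition prefixes (X : finType) (w : word X) : seq (word X) :=
  foldr (fun l L => [::] :: map (cons l) L) [:: [::]] w.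

Lemma prefixesP (X : finType) (w u : word X) :
  reflect (exists v, w = u ++ v) (u \in prefixes w).
Proof.
apply: (iffP idP).
  elim: w u => [|l w IHw] u /=; first by rewrite inE => /eqP->; exists [::].
  rewrite inE => /predU1P[->|/mapP[u' /IHw[v ->] ->]]; first by exists (l :: w).
  by exists v.
move=> [v ->]; elim: u => [|l u IHu]; first by case: v => [|? ?]; rewrite inE eqxx.
by rewrite /= inE; apply/orP; right; apply: map_f.
Qed.

Definition letters (X : finType) : seq (letter X) := enum {: letter X}.

Section Existence.
Variables (X : finType) (m : nat).
Notation elt := (word X * vec m)%type.
Notation arcd := ((word X * letter X) * (word X * vec m))%type.
Implicit Types (S : seq elt) (E : seq arcd).

Lemma lookup_none E p l t : machine_lookup E p l = None -> ((p, l), t) \notin E.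
Proof.
rewrite /machine_lookup; elim: E => //= -[pl t'] E IHE; rewrite same_codeE inE negb_or.
case: eqP => //= ne /IHE ->; rewrite andbT.
by apply/eqP => -[e _]; apply: ne; rewrite -e.
Qed.

(** The machine is the part of the Schreier graph of the projection that is spanned
by the cosets of the prefixes of the generators. *)
Lemma exists_valid S : exists E n, valid_machine S E n.
Proof.
pose K := span_elts S; have sK : is_subgroup K := generated_subgroup _.
have [lab [labP labV]] := class_label sK.
pose coset_rep := class_rep K.
pose P := flatten [seq [seq coset_rep u | u <- prefixes x.1] | x : elt <- S].
pose E : seq arcd := [seq (pl, (coset_rep (rcons pl.1 pl.2), lab pl.1 pl.2)) | pl <-
  [seq pl <- flatten [seq [seq (p, l) | l <- letters X] | p <- P] |
   coset_rep (rcons pl.1 pl.2) \in P]].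
have repP p : p \in P -> coset_rep p = p.
  by case/flatten_mapP => x _ /mapP[u _ ->]; apply: class_rep_id.
have EP p l t : ((p, l), t) \in E ->
    [/\ p \in P, coset_rep (rcons p l) \in P & t = (coset_rep (rcons p l), lab p l)].
  move=> /mapP[[p' l']]; rewrite mem_filter => /andP[+ /flatten_mapP[p2 p2P /mapP[l2 _]]].
  by move=> /= qP [ep el] [ep' el' ->]; rewrite ep' el'; split=> //; rewrite ep.
have lookupE p l : p \in P -> coset_rep (rcons p l) \in P ->
    machine_lookup E p l = Some (coset_rep (rcons p l), lab p l).
  move=> pP qP; case e : (machine_lookup E p l) => [t|].
    by have [_ _ ->] := EP _ _ _ (lookup_some e).
  have /negP[] := lookup_none (coset_rep (rcons p l), lab p l) e.
  apply/mapP; exists (p, l) => //; rewrite mem_filter qP /=.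
  by apply/flatten_mapP; exists p => //; apply/mapP; exists l; rewrite // mem_enum.
(* One rank of [products] serves all the arcs, since there are finitely many. *)
have [n nP] : exists n, forall e, e \in E ->
    (reduce (e.1.1 ++ e.1.2 :: inv_word e.2.1), e.2.2) \in products S n.
  have : forall e, e \in E -> exists n,
      (reduce (e.1.1 ++ e.1.2 :: inv_word e.2.1), e.2.2) \in products S n.
    move=> [[p l] t] /EP[pP qP ->] /=.
    by have [n nP] := products_complete (labP p l (repP _ pP)); exists n.
  elim: (E) => [|e E' IHE] H; first by exists 0%N.
  have [n1 H1] := H e (mem_head _ _).
  have [|n2 H2] := IHE; first by move=> f fE; apply: H; rewrite inE fE orbT.
  exists (maxn n1 n2) => f; rewrite inE => /predU1P[->|fE].
    exact: products_mono (leq_maxl _ _) H1.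
  by apply: products_mono (leq_maxr _ _) _; apply: H2.
exists E, n; apply/andP; split; apply/allP.
  move=> [[p l] t] pE; have [pP qP te] := EP _ _ _ pE.
  apply/andP; split; last by apply/hasP; exists (reduce (p ++ l :: inv_word t.1), t.2);
    [exact: nP pE | rewrite same_codeE].
  have rp : coset_rep (rcons (coset_rep (rcons p l)) (linv l)) = p.
    rewrite /coset_rep class_rep_rcons // -[RHS](repP _ pP); apply: (class_rep_inj sK).
    by apply: (coset_eq_fg sK); rewrite fg_rcons_linv.
  rewrite te /= lookupE ?rp // same_codeE (labV _ _ (repP _ pP)).
  by rewrite /vec_sub /vec0 sub0r.
move=> x xS.
have readP u : u \in prefixes x.1 -> exists a, machine_read E u = Some (coset_rep u, a).
  elim/last_ind: u => [|u l IHu] up.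
    exists (vec0 m); rewrite /machine_read /= /coset_rep class_rep_nil //; exact: proj_nil.
  have inP v : v \in prefixes x.1 -> coset_rep v \in P.
    by move=> vp; apply/flatten_mapP; exists x => //; apply: map_f.
  have up' : u \in prefixes x.1.
    by have /prefixesP[v xe] := up; apply/prefixesP; exists (l :: v); rewrite xe cat_rcons.
  have [a ua] := IHu up'; exists (vec_add a (lab (coset_rep u) l)).
  rewrite /machine_read -cats1 run_cat -/(machine_read _ _) ua /machine_run /=.
  have repR : coset_rep (rcons (coset_rep u) l) = coset_rep (rcons u l) by apply: class_rep_rcons.
  have lk : machine_lookup E (coset_rep u) l = Some (coset_rep (rcons u l), lab (coset_rep u) l).
    by rewrite -repR; apply: lookupE; rewrite ?repR; apply: inP.
  by rewrite lk cats1.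
have [|a ->] := readP x.1; first by apply/prefixesP; exists [::]; rewrite cats0.
rewrite same_codeE /= /coset_rep class_rep_nil //; exists x.2; exact: span_elts_mem.
Qed.

End Existence.

Local Close Scope group_scope.
(** * Membership in the projection of the intersection, and representatives *)

Local Open Scope group_scope.

Notation elt X m := (word X * vec m)%type.
Notation arc_data X m := ((word X * letter X) * (word X * vec m))%type.

Section ComputableMachine.
Variables (X : finType) (m : nat).

Lemma computable_elt_div (C : Type) (cC : coded C) (x y : C -> elt X m) :
  computable x -> computable y -> computable (fun z => elt_div (x z) (y z)).
Proof. by move=> cx cy; rewrite /elt_div; computability. Qed.
#[local] Hint Resolve computable_elt_div : computability.

Lemma computable_products (C : Type) (cC : coded C) (S : C -> seq (elt X m)) (n : C -> nat) :
  computable S -> computable n -> computable (fun z => products (S z) (n z)).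
Proof. by move=> cS cn; rewrite /products; computability. Qed.
#[local] Hint Resolve computable_products : computability.

Lemma computable_machine_lookup (C : Type) (cC : coded C) (E : C -> seq (arc_data X m))
    (p : C -> word X) (l : C -> letter X) :
  computable E -> computable p -> computable l ->
  computable (fun z => machine_lookup (E z) (p z) (l z)).
Proof. by move=> cE cp cl; rewrite /machine_lookup; computability. Qed.
#[local] Hint Resolve computable_machine_lookup : computability.

Lemma computable_machine_step (C : Type) (cC : coded C) (E : C -> seq (arc_data X m))
    (s : C -> option (elt X m)) (l : C -> letter X) :
  computable E -> computable s -> computable l ->
  computable (fun z => machine_step (E z) (s z) (l z)).
Proof. by move=> cE cs cl; rewrite /machine_step; computability. Qed.
#[local] Hint Resolve computable_machine_step : computability.

Lemma computable_machine_read (C : Type) (cC : coded C) (E : C -> seq (arc_data X m)) (w : C -> word X) :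
  computable E -> computable w -> computable (fun z => machine_read (E z) (w z)).
Proof. by move=> cE cw; rewrite /machine_read /machine_run; computability. Qed.
#[local] Hint Resolve computable_machine_read : computability.

Lemma computable_valid_machine (C : Type) (cC : coded C) (S : C -> seq (elt X m))
    (E : C -> seq (arc_data X m)) (n : C -> nat) :
  computable S -> computable E -> computable n ->
  computable (fun z => valid_machine (S z) (E z) (n z)).
Proof. by move=> cS cE cn; rewrite /valid_machine; computability. Qed.

Lemma computable_abelian_part (C : Type) (cC : coded C) (S : C -> seq (elt X m))
    (E : C -> seq (arc_data X m)) :
  computable S -> computable E -> computable (fun z => abelian_part (S z) (E z)).
Proof. by move=> cS cE; rewrite /abelian_part; computability. Qed.

Lemma computable_prefixes (C : Type) (cC : coded C) (w : C -> word X) :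
  computable w -> computable (fun z => prefixes (w z)).
Proof. by move=> cw; rewrite /prefixes; computability. Qed.

Lemma machine_search : exists2 f : seq (elt X m) -> seq (arc_data X m),
  computable f & forall S, exists n, valid_machine S (f S) n.
Proof.
have [|||f cf fP] := @computable_search (seq (elt X m)) (seq (arc_data X m) * nat)%type _ _
  ([::], 0%N) (fun S p => valid_machine S p.1 p.2).
- apply: enumerable_pair enumerable_nat; apply: enumerable_seq; apply: enumerable_pair.
    exact: enumerable_pair (enumerable_word X) (enumerable_letter X).
  exact: enumerable_pair (enumerable_word X) (enumerable_vec m).
- by have := computable_valid_machine; computability.
- by move=> S; have [E [n v]] := exists_valid S; exists (E, n).
- by exists (fun S => (f S).1); [computability | move=> S; exists (f S).2].
Qed.

End ComputableMachine.
#[export] Hint Resolve computable_machine_read computable_abelian_part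
  computable_prefixes : computability.

Notation machine_pair X m :=
  ((seq (elt X m) * seq (arc_data X m)) * (seq (elt X m) * seq (arc_data X m)))%type.

Section Completion.
Variables (X : finType) (m : nat).
Implicit Types (D : machine_pair X m) (u v w : word X) (c : vec m).

(** A vector c such that w t^c is in both subgroups, if there is one. The trivial word
gets the vector 0, which makes the labels of the arcs of the tree vanish. *)
Definition completion D w : option (vec m) :=
  if same_code (reduce w) [::] then Some (vec0 m) else
  if machine_read D.1.2 (reduce w) is Some s then
    if machine_read D.2.2 (reduce w) is Some t then
      if same_code s.1 [::] && same_code t.1 [::] then
        coset_meet (abelian_part D.1.1 D.1.2) (abelian_part D.2.1 D.2.2) s.2 t.2
      else None
    else None
  else None.

Lemma computable_completion (C : Type) (cC : coded C) (D : C -> machine_pair X m) (w : C -> word X) :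
  computable D -> computable w -> computable (fun z => completion (D z) (w z)).
Proof. by move=> cD cw; rewrite /completion; computability. Qed.

Definition correct_pair D : Prop :=
  (exists n, valid_machine D.1.1 D.1.2 n) /\ (exists n, valid_machine D.2.1 D.2.2 n).

Definition pair_meet D : set (FxA X (vec m)) := span_elts D.1.1 `&` span_elts D.2.1.

Lemma pair_meet_subgroup D : is_subgroup (pair_meet D).
Proof.
have s1 : is_subgroup (span_elts D.1.1) := generated_subgroup _.
have s2 : is_subgroup (span_elts D.2.1) := generated_subgroup _.
split=> [|x y [x1 x2] [y1 y2]]; first by split; [exact: s1.1 | exact: s2.1].
by split; [exact: s1.2 | exact: s2.2].
Qed.

Lemma completion_fg D u v : fg_of_word u = fg_of_word v -> completion D u = completion D v.
Proof. by move/fg_of_wordE; rewrite /completion => ->. Qed.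

Lemma completion_triv D w : fg_of_word w = 1 -> completion D w = Some (vec0 m).
Proof. by rewrite -fg_of_word_nil => /completion_fg->; rewrite /completion same_codeE. Qed.

Lemma span_eltsD (S : seq (elt X m)) (g : freegroup X) a c : span_elts S (g, a) ->
  span_elts S (1, (c - a)%R) -> span_elts S (g, c).
Proof.
move=> h1 h2; have := subgroupM (generated_subgroup _) h1 h2.
congr (span_elts S _); congr (_, _); first exact: mulg1.
by change ((a + (c - a))%R = c); rewrite addrC subrK.
Qed.

Lemma completion_some D w c : correct_pair D -> completion D w = Some c ->
  pair_meet D (fg_of_word w, c).
Proof.
move=> [[n1 v1] [n2 v2]]; rewrite /completion same_codeE; case: eqP => [w1 [<-]|_].
  have /fg_of_wordE -> : reduce w = reduce [::] by rewrite w1.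
  exact: (pair_meet_subgroup D).1.
case e1 : machine_read => [[p a]|] //; case e2 : machine_read => [[q b]|] //.
rewrite !same_codeE /=; case: eqP e1 => // -> e1; case: eqP e2 => // -> e2 /=.
move/coset_meet_some => [c1 c2]; rewrite -(fg_of_word_reduce w); split.
  apply: span_eltsD (valid_read_sound v1 e1) _; exact: (abelian_part_sound v1 c1).
apply: span_eltsD (valid_read_sound v2 e2) _; exact: (abelian_part_sound v2 c2).
Qed.

Lemma completion_none D w : correct_pair D -> completion D w = None ->
  ~ proj (pair_meet D) w.
Proof.
move=> [[n1 v1] [n2 v2]] + [c [k1 k2]]; rewrite /completion same_codeE; case: eqP => // _.
have [a -> s1] := valid_read_complete v1 k1.
have [b -> s2] := valid_read_complete v2 k2.
by rewrite /= ?same_codeE /= => /coset_meet_none /(_ s1); apply.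
Qed.

Lemma completionP D w : correct_pair D ->
  reflect (proj (pair_meet D) w) (isSome (completion D w)).
Proof.
move=> pairD; case e : (completion D w) => [c|]; constructor; last exact: completion_none e.
by exists c; apply: completion_some.
Qed.

Definition abelian_meet D : seq (vec m) :=
  meet (abelian_part D.1.1 D.1.2) (abelian_part D.2.1 D.2.2).

Lemma abelian_meetP D c : correct_pair D ->
  pair_meet D (1, c) <-> zspan (abelian_meet D) c.
Proof.
move=> [[n1 v1] [n2 v2]]; rewrite meetP -(abelian_partP v1) -(abelian_partP v2).
by split=> -[].
Qed.

Lemma computable_abelian_meet : computable (fun D : machine_pair X m => abelian_meet D).
Proof. by rewrite /abelian_meet; computability. Qed.

End Completion.
#[export] Hint Resolve computable_completion : computability.

Section BreadthFirst.
Variables (X : finType) (eqv : word X -> word X -> bool).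
Implicit Types (u v w : word X) (l : letter X) (L : seq (word X)).

Definition add_new L u : seq (word X) := if has (eqv u) L then L else rcons L u.

(** Breadth-first search in the Schreier graph: the extensions of known representatives
by one letter are added when their coset is new. Thus representatives are closed
under prefixes and pairwise inequivalent, and every coset of a word of length n is
met at rank n. *)
Definition bfs n : seq (word X) :=
  iter n (fun L => foldl add_new L
    (flatten [seq [seq rcons v l | l <- letters X] | v <- L])) [:: [::]].

Definition tree_rep u : word X := head [::] [seq v <- bfs (size u) | eqv u v].

Variables (V : zmodType) (K : set (FxA X V)).
Hypothesis sK : is_subgroup K.
Hypothesis eqvP : forall u v, reflect (coset_eq K u v) (eqv u v).

Definition separated L : Prop :=
  forall u v, u \in L -> v \in L -> coset_eq K u v -> u = v.

Lemma add_new_mono L us v : v \in L -> v \in foldl add_new L us.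
Proof.
elim: us L => //= u us IHus L vL; apply: IHus.
by rewrite /add_new; case: ifP; rewrite // mem_rcons inE vL orbT.
Qed.

Lemma add_new_origin L us v : v \in foldl add_new L us -> v \in L \/ v \in us.
Proof.
elim: us L => [|u us IHus] L /=; first by left.
move/IHus => [|vu]; last by right; rewrite inE vu orbT.
rewrite /add_new; case: ifP => _; first by left.
rewrite mem_rcons inE => /predU1P[->|]; last by left.
by right; rewrite inE eqxx.
Qed.

Lemma add_new_cover L us u : u \in us ->
  exists2 v, v \in foldl add_new L us & coset_eq K u v.
Proof.
elim: us L => //= u' us IHus L; rewrite inE => /predU1P[->|/IHus//].
suff [v vL uv] : exists2 v, v \in add_new L u' & coset_eq K u' v.
  by exists v => //; apply: add_new_mono.
rewrite /add_new; case: ifP => [/hasP[v vL /eqvP uv]|_]; first by exists v.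
by exists u'; [rewrite mem_rcons inE eqxx | apply: coset_eq_refl].
Qed.

Lemma add_new_separated L us : separated L -> separated (foldl add_new L us).
Proof.
elim: us L => //= u us IHus L sL; apply: IHus.
rewrite /add_new; case: ifP => // /hasPn new v w.
rewrite !mem_rcons !inE => /predU1P[->|vL] /predU1P[->|wL] //.
- by move/eqvP; rewrite (negPf (new _ wL)).
- by move/(coset_eq_sym sK)/eqvP; rewrite (negPf (new _ vL)).
- exact: sL.
Qed.

Lemma bfs_mono n k v : (n <= k)%N -> v \in bfs n -> v \in bfs k.
Proof.
move=> /subnK <-; elim: (k - n)%N => //= i IHi /IHi; exact: add_new_mono.
Qed.

Lemma bfs_separated n : separated (bfs n).
Proof.
elim: n => [|n IHn]; last exact: add_new_separated.
by move=> u v; rewrite !inE => /eqP-> /eqP->.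
Qed.

Lemma bfs_nil n : [::] \in bfs n.
Proof. by apply: (bfs_mono (leq0n n)); rewrite inE. Qed.

Lemma bfs_parent n v l : rcons v l \in bfs n -> v \in bfs n.
Proof.
elim: n => [|n IHn]; first by rewrite inE; case: v.
rewrite /= => /add_new_origin[/IHn|/flatten_mapP[u un /mapP[l' _ /rcons_inj[-> _]]]];
  exact: add_new_mono.
Qed.

Lemma bfs_cover n u : (size u <= n)%N -> exists2 v, v \in bfs n & coset_eq K u v.
Proof.
elim: n u => [|n IHn] u.
  by rewrite leqn0 => /nilP ->; exists [::]; [rewrite inE | exact: coset_eq_refl].
elim/last_ind: u => [_|u l _]; first by exists [::]; [apply: bfs_nil | exact: coset_eq_refl].
rewrite size_rcons ltnS => /IHn[v vn uv].
have [|w wn vw] := @add_new_cover (bfs n)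
    (flatten [seq [seq rcons v l | l <- letters X] | v <- bfs n]) (rcons v l).
  by apply/flatten_mapP; exists v => //; apply: map_f; rewrite mem_enum.
by exists w => //; apply: (coset_eq_trans sK) vw; apply: coset_eq_rcons.
Qed.

Lemma tree_rep_bfs u : tree_rep u \in bfs (size u) /\ coset_eq K u (tree_rep u).
Proof.
rewrite /tree_rep; have [v vn /eqvP uv] := bfs_cover (leqnn (size u)).
have : v \in [seq v <- bfs (size u) | eqv u v] by rewrite mem_filter uv.
case e : [seq v <- bfs (size u) | eqv u v] => [|w s] // _.
have : w \in [seq v <- bfs (size u) | eqv u v] by rewrite e inE eqxx.
by rewrite mem_filter => /andP[/eqvP].
Qed.

Lemma tree_rep_eq u : coset_eq K u (tree_rep u).
Proof. exact: (tree_rep_bfs u).2. Qed.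

Lemma bfs_tree_rep n u v : v \in bfs n -> coset_eq K u v -> tree_rep u = v.
Proof.
move=> vn uv; have [rb ur] := tree_rep_bfs u.
apply: (@bfs_separated (maxn n (size u))).
- exact: bfs_mono (leq_maxr _ _) rb.
- exact: bfs_mono (leq_maxl _ _) vn.
- by apply: (coset_eq_trans sK) uv; apply: coset_eq_sym.
Qed.

Lemma tree_rep_inj u v : coset_eq K u v -> tree_rep u = tree_rep v.
Proof.
move=> uv; apply: bfs_tree_rep (tree_rep_bfs v).1 _.
exact: coset_eq_trans uv (tree_rep_eq v).
Qed.

Lemma tree_repK u : tree_rep (tree_rep u) = tree_rep u.
Proof. by apply: tree_rep_inj; apply: coset_eq_sym => //; apply: tree_rep_eq. Qed.

Lemma tree_rep_nil : tree_rep [::] = [::].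
Proof. exact: bfs_tree_rep (bfs_nil 0) (coset_eq_refl sK _). Qed.

(** The parent of a vertex in the spanning tree. *)
Lemma tree_rep_parent v l : tree_rep (rcons v l) = rcons v l -> tree_rep v = v.
Proof.
move=> r; have [+ _] := tree_rep_bfs (rcons v l); rewrite r => /bfs_parent vn.
exact: bfs_tree_rep vn (coset_eq_refl sK _).
Qed.

(** If a representative had a factor l l^-1, the prefixes before and after it
would be two representatives of the same coset. *)
Lemma tree_rep_reduced v : tree_rep v = v -> reduced_word v.
Proof.
elim/last_ind: v => // v l IHv r; have rv := tree_rep_parent r.
elim/last_ind: v rv r IHv => // v l' _ rv r /(_ rv) red.
rewrite /reduced_word -cats1 -cats1 -catA /=.
case: (eqVneq l (linv l')) => [ll|ne].
  have := congr1 size r; have rv' := tree_rep_parent rv.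
  have -> : tree_rep (rcons (rcons v l') l) = v.
    rewrite -[RHS]rv'; apply: tree_rep_inj; apply: (coset_eq_fg sK).
    by rewrite ll fg_rcons_linv.
  by rewrite !size_rcons; lia.
move: red; rewrite /reduced_word; case: v {rv r} => [_|a v] /=; first by rewrite ne.
by rewrite rcons_path cat_path /= => /andP[-> ->]; rewrite ne.
Qed.

End BreadthFirst.

Lemma computable_tree_rep (X : finType) (C : Type) (cC : coded C)
    (eqv : C -> word X -> word X -> bool) (u : C -> word X) :
  computable (fun p : C * (word X * word X) => eqv p.1 p.2.1 p.2.2) ->
  computable u -> computable (fun z => tree_rep (eqv z) (u z)).
Proof. by move=> ce cu; rewrite /tree_rep /bfs /add_new; computability. Qed.
#[export] Hint Resolve computable_tree_rep : computability.

Local Close Scope group_scope.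
(** * The Stallings automaton of the intersection *)

Local Open Scope group_scope.

Section Core.
Variables (X : finType) (m : nat).
Implicit Types (D : machine_pair X m) (u v w p q : word X) (l : letter X).

Definition same_coset D u v : bool := isSome (completion D (u ++ inv_word v)).
Definition coset_rep D u : word X := tree_rep (same_coset D) u.
Definition arc_label D p l : vec m :=
  odflt (vec0 m) (completion D (p ++ l :: inv_word (coset_rep D (rcons p l)))).
(** The two vectors of an arc: the one of a positive arc is its second label, and a
negative arc is labelled as the inverse of a positive one. *)
Definition label1 D p l : vec m :=
  if positive l then vec0 m else arc_label D (coset_rep D (rcons p l)) (linv l).
Definition label2 D p l : vec m := if positive l then arc_label D p l else vec0 m.

Variable D : machine_pair X m.
Hypothesis pairD : correct_pair D.
Let H := pair_meet D.
Let sH : is_subgroup H := pair_meet_subgroup D.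

Lemma same_cosetP u v : reflect (coset_eq H u v) (same_coset D u v).
Proof. exact: completionP. Qed.

Lemma coset_rep_eq u : coset_eq H u (coset_rep D u).
Proof. exact: tree_rep_eq sH same_cosetP u. Qed.

Lemma coset_rep_inj u v : coset_eq H u v -> coset_rep D u = coset_rep D v.
Proof. exact: tree_rep_inj sH same_cosetP u v. Qed.

Lemma coset_repK u : coset_rep D (coset_rep D u) = coset_rep D u.
Proof. exact: tree_repK sH same_cosetP u. Qed.

Lemma coset_rep_nil : coset_rep D [::] = [::].
Proof. exact: tree_rep_nil sH same_cosetP. Qed.

Lemma coset_rep_unique p u : coset_rep D p = p -> coset_eq H u p -> p = coset_rep D u.
Proof. by move=> rvp /coset_rep_inj ->; rewrite rvp. Qed.

Lemma coset_rep_linv p l : coset_rep D p = p ->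
  coset_rep D (rcons (coset_rep D (rcons p l)) (linv l)) = p.
Proof.
move=> rp; apply: esym; apply: coset_rep_unique => //; apply: (coset_eq_sym sH).
by apply: (coset_eq_linv sH); apply: coset_rep_eq.
Qed.

Lemma arc_labelP p l :
  H (fg_of_word p * fg_of_word [:: l] / fg_of_word (coset_rep D (rcons p l)), arc_label D p l).
Proof.
rewrite -fg_of_word_inv -!fg_of_word_cat cats1 cat_rcons /arc_label.
have /same_cosetP := coset_rep_eq (rcons p l); rewrite /same_coset cat_rcons.
by case e : completion => [c|] //= _; apply: completion_some e.
Qed.

Lemma label_diffP p l : coset_rep D p = p ->
  H (fg_of_word p * fg_of_word [:: l] / fg_of_word (coset_rep D (rcons p l)),
     (label2 D p l - label1 D p l)%R).
Proof.
move=> rp; rewrite /label1 /label2 /vec0; case: ifP => _.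
  by rewrite subr0; apply: arc_labelP.
have := subgroup_pairV sH (arc_labelP (coset_rep D (rcons p l)) (linv l)).
rewrite coset_rep_linv // fg_of_letterV sub0r.
by rewrite !invgM !invgK -mulgA.
Qed.

(** The coset of p is visited by a closed walk at the base that reads a reduced word of
length at most k. *)
Definition core_vertex k p : Prop := exists u1 u2,
  [/\ (size (u1 ++ u2) <= k)%N, reduced_word (u1 ++ u2), proj H (u1 ++ u2) & coset_eq H u1 p].
Definition core_arc k p l : Prop := exists u1 u2,
  [/\ (size (u1 ++ l :: u2) <= k)%N, reduced_word (u1 ++ l :: u2),
      proj H (u1 ++ l :: u2) & coset_eq H u1 p].

Lemma core_vertex_mono k k' p : (k <= k')%N -> core_vertex k p -> core_vertex k' p.
Proof.
move=> kk [u1 [u2 [s r pr c]]]; exists u1, u2; split=> //; exact: leq_trans kk.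
Qed.

Lemma core_arc_mono k k' p l : (k <= k')%N -> core_arc k p l -> core_arc k' p l.
Proof.
move=> kk [u1 [u2 [s r pr c]]]; exists u1, u2; split=> //; exact: leq_trans kk.
Qed.

Lemma core_arc_source k p l : core_arc k p l -> core_vertex k p.
Proof. by move=> [u1 [u2 c]]; exists u1, (l :: u2). Qed.

Lemma core_arc_target k p l : core_arc k p l -> core_vertex k (coset_rep D (rcons p l)).
Proof.
move=> [u1 [u2 [s r pr c]]]; exists (rcons u1 l), u2; rewrite cat_rcons; split=> //.
apply: coset_eq_trans (coset_rep_eq _) => //; exact: coset_eq_rcons.
Qed.

Lemma core_arc_inv k p l : core_arc k p l -> core_arc k (coset_rep D (rcons p l)) (linv l).
Proof.
move=> [u1 [u2 [s r pr c]]]; exists (inv_word u2), (inv_word u1).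
have -> : inv_word u2 ++ linv l :: inv_word u1 = inv_word (u1 ++ l :: u2).
  by rewrite inv_word_cat inv_word_cons cat_rcons.
split.
- by rewrite /inv_word size_rev size_map.
- exact: reduced_inv_word.
- exact: proj_inv.
- apply: coset_eq_trans (coset_rep_eq _) => //; apply: coset_eq_sym => //.
  apply: (coset_eq_trans sH (v := rcons u1 l)).
    by apply: coset_eq_sym => //; apply: coset_eq_rcons.
  by rewrite /coset_eq inv_wordK cat_rcons.
Qed.

Lemma core_vertex_nil k : core_vertex k [::].
Proof.
exists [::], [::]; split=> //; [exact: proj_nil | exact: coset_eq_refl].
Qed.

(** The tree paths to the vertices of the core stay in the core. Let w = u1 u2 be a
reduced word of the projection that reaches p l after u1. If u1 ends with l, then
w reaches p just before and follows the arc; otherwise p l u1^-1 is reduced and lies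
in the projection, and its walk follows the arc. *)
Lemma core_arc_tree k p l : coset_rep D (rcons p l) = rcons p l ->
  core_vertex k (rcons p l) -> exists k', core_arc k' p l.
Proof.
move=> rpl [u1 [u2 [s r pr c]]].
have redpl : reduced_word (rcons p l) := tree_rep_reduced sH same_cosetP rpl.
have far : proj H (rcons p l ++ inv_word u1) by apply: coset_eq_sym.
have red_far : reduced_word (rcons p l ++ inv_word u1) ->
    exists k', core_arc k' p l.
  rewrite cat_rcons in far *; move=> red; exists (size (p ++ l :: inv_word u1)), p, (inv_word u1).
  by split=> //; apply: coset_eq_refl.
case: (lastP u1) s r pr c far red_far => [|u l'] s r pr c far red_far.
  by apply: red_far; rewrite cats0.
case: (eqVneq l' l) => [ll|ne].
  exists k, u, u2; rewrite -cat_rcons -ll; split=> //.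
  by apply: (coset_eq_rconsK (l := l)); rewrite -{1}ll.
apply: red_far; rewrite inv_word_rcons cat_rcons.
have redu : reduced_word (linv l' :: inv_word u).
  rewrite -inv_word_rcons; apply: reduced_inv_word.
  by move: r; rewrite /reduced_word => /cat_sorted2[].
move: redpl redu; rewrite /reduced_word -cats1; case: p {rpl far c} => [|x p] /=.
  move=> _ ->; rewrite andbT; apply: contra ne => /eqP /(congr1 (@linv X)).
  by rewrite !linvK => ->.
rewrite !cat_path /= andbT => /andP[-> ->] ->; rewrite andbT.
by apply: contra ne => /eqP /(congr1 (@linv X)); rewrite !linvK => ->.
Qed.

End Core.

Section Graph.
Variables (X : finType) (A : zmodType) (m : nat) (phi : vec m -> A).
Hypothesis phiB : forall c d : vec m, phi (c - d)%R = (phi c - phi d)%R.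
Variable D : machine_pair X m.
Hypothesis pairD : correct_pair D.
Local Notation H := (pair_meet D).
Local Notation rp := (coset_rep D).
Implicit Types (u v w : word X) (l : letter X).

Let sH : is_subgroup H := pair_meet_subgroup D.

Let phi0 : phi 0%R = 0%R. Proof. exact: additive_fun0. Qed.
Let phiD c d : phi (c + d)%R = (phi c + phi d)%R. Proof. exact: additive_funD. Qed.

Definition is_vertex (p : word X) : bool := `[< rp p = p /\ exists k, core_vertex D k p >].
Definition is_arc (x : word X * letter X) : bool :=
  `[< rp x.1 = x.1 /\ exists k, core_arc D k x.1 x.2 >].

Definition graph_vertex := {p | is_vertex p}.
Definition graph_arc := {x | is_arc x}.

Lemma is_arc_source x : is_arc x -> is_vertex x.1.
Proof.
by move=> /asboolP[r [k c]]; apply/asboolP; split=> //; exists k; apply: core_arc_source c.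
Qed.

Lemma is_arc_target x : is_arc x -> is_vertex (rp (rcons x.1 x.2)).
Proof.
move=> /asboolP[r [k c]]; apply/asboolP; split; first exact: coset_repK.
by exists k; apply: core_arc_target.
Qed.

Definition inv_arc (x : word X * letter X) := (rp (rcons x.1 x.2), linv x.2).

Lemma is_arc_inv x : is_arc x -> is_arc (inv_arc x).
Proof.
move=> /asboolP[r [k c]]; apply/asboolP; split; first exact: coset_repK.
by exists k; apply: core_arc_inv.
Qed.

Lemma is_vertex_nil : is_vertex [::].
Proof.
by apply/asboolP; split; [exact: coset_rep_nil | exists 0%N; exact: core_vertex_nil].
Qed.

Definition graph_source (e : graph_arc) : graph_vertex := exist _ (val e).1 (is_arc_source (valP e)).
Definition graph_target (e : graph_arc) : graph_vertex :=
  exist _ (rp (rcons (val e).1 (val e).2)) (is_arc_target (valP e)).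
Definition graph_arc_inv (e : graph_arc) : graph_arc := exist _ (inv_arc (val e)) (is_arc_inv (valP e)).
Definition graph_base : graph_vertex := exist _ [::] is_vertex_nil.
Definition graph_label (e : graph_arc) : letter X := (val e).2.

Lemma graph_arc_rep (e : graph_arc) : rp (val e).1 = (val e).1.
Proof. by have /asboolP[] := valP e. Qed.

Lemma graph_arc_invK : involutive graph_arc_inv.
Proof.
move=> e; apply: val_inj; rewrite /= /inv_arc /= coset_rep_linv ?graph_arc_rep // linvK.
by case: (val e).
Qed.

Lemma graph_source_inv e : graph_source (graph_arc_inv e) = graph_target e.
Proof. exact: val_inj. Qed.

Definition core_automaton : automaton X :=
  @Automaton X graph_vertex graph_arc graph_source graph_target graph_label graph_arc_inv graph_base
    graph_arc_invK graph_source_inv (fun e => erefl).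

Definition graph_abel1 (e : Defs.arc core_automaton) : A := phi (label1 D (val e).1 (val e).2).
Definition graph_abel2 (e : Defs.arc core_automaton) : A := phi (label2 D (val e).1 (val e).2).

Lemma graph_abel1_inv e : graph_abel1 (arc_inv e) = graph_abel2 e.
Proof.
rewrite /graph_abel1 /graph_abel2 /label1 /label2 /=; congr phi.
rewrite coset_rep_linv ?graph_arc_rep // linvK /positive /=.
by case: (val e).2 => x [].
Qed.

Definition graph_base_group : set A := [set phi c | c in [set c | H (1, c)]].

Lemma graph_base_groupP : is_subgroup (graph_base_group : set (texp A)).
Proof.
split=> [|_ _ [c Hc <-] [d Hd <-]]; first by exists 0%R; [exact: sH.1 | exact: phi0].
exists (c - d)%R; last exact: phiB.
have := sH.2 _ _ Hc Hd; congr (pair_meet D _); congr (_, _); exact: mulgV.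
Qed.

Definition stallings_graph : enriched X A :=
  @Enriched X A core_automaton graph_abel1 graph_abel2 graph_base_group graph_abel1_inv graph_base_groupP.

Local Notation G := stallings_graph.

Lemma deterministic_graph : deterministic G.
Proof.
move=> e f; rewrite /= /graph_label => ef; suff h : (val e).1 = (val f).1 -> e = f.
  case=> [/(congr1 val)/h//|/(congr1 val) /= t]; apply: h.
  by rewrite -(graph_arc_rep e) -(graph_arc_rep f) -(coset_rep_linv pairD (val e).2 (graph_arc_rep e)) t ef
    coset_rep_linv ?graph_arc_rep // graph_arc_rep.
by move=> sef; apply: val_inj; move: sef ef; case: (val e) => a b; case: (val f) => c d /= -> ->.
Qed.

Lemma no_backtracking_reduced (p q : vertex G) s : is_walk (D := G) p s q -> no_backtracking s ->
  reduced_word [seq label e | e <- s].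
Proof.
elim: s p => // e s IHs p [_]; case: s IHs => // f s IHs fw nb.
have := IHs _ fw; rewrite /reduced_word /= => ->; last first.
  by move=> s1 g s2 E; apply: (nb (e :: s1) g s2); rewrite E.
rewrite andbT; apply/eqP => lf; case: fw => sf _.
apply: (nb [::] e s); congr [:: _, _ & _].
apply: (deterministic_graph); first exact: lf.
by left; rewrite sf source_inv.
Qed.

Lemma reduced_no_backtracking (s : seq (Defs.arc G)) :
  reduced_word [seq label e | e <- s] -> no_backtracking s.
Proof.
move=> red s1 e s2 sE; move: red; rewrite sE map_cat /reduced_word => /cat_sorted2[_] /=.
by rewrite /graph_label /= eqxx.
Qed.

(** A reduced word of the projection is read along a walk in the core, starting
anywhere in the word. *)
Lemma core_walk u w v (p q : vertex G) :
  reduced_word (u ++ w ++ v) -> proj H (u ++ w ++ v) ->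
  coset_eq H u (val p) -> coset_eq H (u ++ w) (val q) ->
  exists2 s, is_walk p s q & [seq label e | e <- s] = w.
Proof.
elim: w u p => [|l w IHw] u p red pr up uwq.
  exists [::] => //=; apply: val_inj; rewrite cats0 in uwq.
  have /asboolP[rvp _] := valP p; have /asboolP[rvq _] := valP q.
  by rewrite (coset_rep_unique pairD rvp up) (coset_rep_unique pairD rvq uwq).
have /asboolP[rvp _] := valP p.
have arcP : is_arc (val p, l).
  by apply/asboolP; split=> //; exists (size (u ++ l :: w ++ v)), u, (w ++ v).
pose e : Defs.arc G := exist _ (val p, l) arcP.
have [||||s ws ls] := IHw (rcons u l) (target e).
- by rewrite cat_rcons.
- by rewrite cat_rcons.
- apply: (coset_eq_trans sH) (coset_rep_eq pairD _); exact: coset_eq_rcons.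
- by rewrite cat_rcons.
by exists (e :: s); [split=> //; apply: val_inj | rewrite /= ls].
Qed.

Lemma core_graph : core G.
Proof.
move=> p; have /asboolP[rvp [k [u1 [u2 [_ red pr c]]]]] := valP p.
have [||||s1 w1 l1] := @core_walk [::] u1 u2 (base G) p => //; first exact: coset_eq_refl.
have [||||s2 w2 l2] := @core_walk u1 u2 [::] p (base G); rewrite ?cats0 //.
  by apply/(coset_eq_nil H).
exists s1, s2; split=> //; apply: reduced_no_backtracking.
by rewrite map_cat l1 l2.
Qed.

Lemma reads_sound (p q : vertex G) g : reads p g q ->
  exists2 c, H (fg_of_word (val p) * g.1 / fg_of_word (val q), c) & g.2 = phi c.
Proof.
elim=> {p g q} [p|e g q _ [c Hc gc]|a g q [d Hd <-] _ [c Hc gc]].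
- exists 0%R; last by rewrite phi0.
  rewrite mulg1 mulgV; exact: sH.1.
- exists (label2 D (val e).1 (val e).2 - label1 D (val e).1 (val e).2 + c)%R; last first.
    by rewrite phiD phiB -gc.
  have := subgroup_pairM sH (label_diffP pairD (val e).2 (graph_arc_rep e)) Hc.
  by rewrite /= !mulgA mulgVK.
- exists (d + c)%R; last by rewrite phiD -gc.
  by have := subgroup_pairM sH Hd Hc; rewrite /= !mul1g.
Qed.

Definition walk_reading (s : seq (Defs.arc G)) : FxA X A :=
  foldr (fun e g => arc_reading e * g) 1 s.

Lemma walk_reads (p q : vertex G) s : is_walk p s q -> reads p (walk_reading s) q.
Proof.
elim: s p => [|e s IHs] p /=; first by move=> ->; constructor.
by move=> [<- /IHs]; apply: (@reads_arc _ _ G).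
Qed.

Lemma walk_reading1 s : (walk_reading s).1 = fg_of_word [seq label e | e <- s].
Proof.
elim: s => //= e s IHs; rewrite -[_ :: [seq _ | _ <- s]]cat1s fg_of_word_cat -IHs.
by [].
Qed.

Lemma recognized_graph : recognized G =
  [set g | exists2 c, H (g.1, c) & g.2 = phi c].
Proof.
apply/seteqP; split=> g /=.
  move=> /reads_sound[c Hc gc]; exists c => //.
  by move: Hc; rewrite /= mul1g invg1 mulg1.
case: g => g x /= [c Hc ->].
have [||||s ws ls] := @core_walk [::] (fgval g) [::] (base G) (base G); rewrite ?cats0 //.
- by case: (g).
- by exists c; rewrite fgvalK.
- exact: coset_eq_refl.
- by apply/(coset_eq_nil H); exists c; rewrite fgvalK.
have rs := walk_reads ws.
have [d Hd sd] := reads_sound rs; rewrite /= mul1g invg1 mulg1 walk_reading1 ls fgvalK in Hd.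
have Hcd : H (1, (c - d)%R).
  have := sH.2 _ _ Hc Hd; congr (pair_meet D _); congr (_, _); exact: mulgV.
have := @reads_abel _ _ G (phi (c - d)%R) _ _ _ rs.
have -> : ((1, phi (c - d)%R) : FxA X A) * walk_reading s = (g, phi c).
  rewrite [walk_reading s]surjective_pairing walk_reading1 ls fgvalK sd.
  congr (_, _); first exact: mul1g.
  by change ((phi (c - d)%R + phi d)%R = phi c); rewrite -phiD subrK.
by apply; exists (c - d)%R.
Qed.

(** The arcs p -l-> q with p l = q in the free group: either q = p l or p = q l^-1 as
words, so that these are the edges between a representative and its parent. *)
Definition tree_arcs : set (Defs.arc G) :=
  [set e | fg_of_word (rcons (val e).1 (val e).2) = fg_of_word (rp (rcons (val e).1 (val e).2))].

Lemma tree_arcs_inv e : tree_arcs e -> tree_arcs (arc_inv e).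
Proof.
rewrite /tree_arcs /= => te; rewrite coset_rep_linv ?graph_arc_rep //.
by rewrite -cats1 fg_of_word_cat -te -fg_of_word_cat cats1 fg_rcons_linv.
Qed.

Lemma walk_in_cat (T : set (Defs.arc G)) s t : walk_in T s -> walk_in T t -> walk_in T (s ++ t).
Proof. by elim: s => //= e s IHs /List.Forall_cons_iff[Te Ts] Tt; constructor => //; exact: IHs. Qed.

Lemma is_walk_cat (p q r : vertex G) s t : is_walk p s q -> is_walk q t r -> is_walk p (s ++ t) r.
Proof. by elim: s p => [|e s IHs] p /=; [move=> -> | move=> [-> /IHs h] /h]. Qed.

Lemma walk_rev (T : set (Defs.arc G)) (p q : vertex G) s :
  (forall e, T e -> T (arc_inv e)) -> walk_in T s -> is_walk p s q ->
  exists2 t, walk_in T t & is_walk q t p.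
Proof.
move=> Tinv; elim: s p => [|e s IHs] p /=; first by exists [::].
move=> /List.Forall_cons_iff[Te Ts] [<- /IHs[//|t Tt wt]].
exists (t ++ [:: arc_inv e]).
  by apply: walk_in_cat => //; constructor => //; apply: Tinv.
apply: is_walk_cat wt _ => /=; split; first exact: graph_source_inv.
by rewrite -graph_source_inv graph_arc_invK.
Qed.

Lemma tree_walk_base (p : vertex G) : exists2 s, walk_in tree_arcs s & is_walk (base G) s p.
Proof.
have [n] := ubnP (size (val p)); elim: n p => // n IHn p.
have /asboolP[rvp [k cp]] := valP p.
move vp : (val p) rvp cp => v; case: (lastP v) vp => [|u l] vp rvp cp sz.
  by exists [::]; [exact: List.Forall_nil | apply: val_inj; rewrite vp].
have [k' ca] := core_arc_tree pairD rvp cp.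
have rvu : rp u = u := tree_rep_parent sH (same_cosetP pairD) rvp.
have arcP : is_arc (u, l) by apply/asboolP; split=> //; exists k'.
pose e : Defs.arc G := exist _ (u, l) arcP.
have [|s Ts ws] := IHn (source e); first by move: sz; rewrite size_rcons.
exists (s ++ [:: e]).
  apply: walk_in_cat => //; constructor => //; rewrite /tree_arcs /=.
  by rewrite rvp.
by apply: is_walk_cat ws _; split=> //; apply: val_inj; rewrite /= rvp vp.
Qed.

Lemma tree_walk_fg (p q : vertex G) s : walk_in tree_arcs s -> is_walk p s q ->
  fg_of_word (val p ++ [seq label e | e <- s]) = fg_of_word (val q).
Proof.
elim: s p => [|e s IHs] p /=; first by move=> _ ->; rewrite cats0.
move=> /List.Forall_cons_iff[Te Ts] [<- ws]; rewrite -(IHs _ Ts ws) -cat_rcons.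
by rewrite !fg_of_word_cat; congr (_ * _).
Qed.

(** Uniqueness of reduced paths is the uniqueness of normal forms in the free group:
the word read along a reduced closed walk in the tree is reduced and trivial. *)
Lemma tree_spanning : spanning_tree tree_arcs.
Proof.
split=> [|p q|p s Ts ws nb]; first exact: tree_arcs_inv.
  have [s Ts ws] := tree_walk_base p; have [t Tt wt] := tree_walk_base q.
  have [r Tr wr] := walk_rev tree_arcs_inv Ts ws.
  by exists (r ++ t); [apply: walk_in_cat | apply: is_walk_cat wr wt].
have red := no_backtracking_reduced ws nb.
have := tree_walk_fg Ts ws; rewrite fg_of_word_cat -[RHS]mulg1 => /mulgI.
by rewrite -fg_of_word_nil => /fg_of_wordE; rewrite reduce_id //=; case: (s).
Qed.

Lemma stallings_graphP : stallings G [set g | exists2 c, H (g.1, c) & g.2 = phi c].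
Proof.
split; first exact: recognized_graph.
exists tree_arcs; first exact: tree_spanning.
split.
- by split; [exact: deterministic_graph | exact: core_graph].
- by move=> e; rewrite /= /graph_abel1 /label1 => ->; rewrite /vec0 phi0.
- move=> e; rewrite /tree_arcs /= => te; rewrite /graph_abel2 /label2 => ->.
  rewrite /arc_label completion_triv /= ?/vec0 ?phi0 // -cat_rcons.
  by rewrite fg_of_word_cat te fg_of_word_inv mulgV.
Qed.

End Graph.

Local Close Scope group_scope.
(** * Coordinates, and descriptions of finite stages *)

Local Open Scope ring_scope.

Lemma zspan_nil (V : zmodType) (x : V) : zspan [::] x <-> x = 0.
Proof.
split=> [sx|->]; last exact: zspan0.
by apply: (sx (fun x => x = 0)) => // y z -> ->; rewrite subrr.
Qed.

(** Filters a subgroup by the vectors whose first i coordinates vanish; each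
step of the filtration is detected by one coordinate, whose image is generated by
any nonzero value that is minimal in absolute value. *)
Lemma subgroup_vec_fg m (M : vec m -> Prop) : M 0 ->
  (forall c d, M c -> M d -> M (c - d)) -> exists rs, forall c, zspan rs c <-> M c.
Proof.
move=> M0 MB.
pose Mi i c := M c /\ forall j, (j < i)%N -> coord j c = 0.
have coord0 j : coord j (0 : vec m) = 0 by rewrite -(subrr 0) coordB subrr.
suff H k : (k <= m)%N -> exists rs, forall c, zspan rs c <-> Mi (m - k)%N c.
  have [rs rsP] := H m (leqnn m); exists rs => c; rewrite rsP subnn.
  by split=> [[]|Mc].
elim: k => [_|k IHk lek].
  exists [::] => c; rewrite zspan_nil subn0; split=> [->|[_ c0]]; first by split.
  by apply: coord_inj => j jm; rewrite coord0; apply: c0.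
have [rs rsP] := IHk (ltnW lek).
rewrite (_ : (m - k = (m - k.+1).+1)%N) in rsP; last by lia.
set i := (m - k.+1)%N in rsP *.
have MiB c d : Mi i c -> Mi i d -> Mi i (c - d).
  move=> [Mc c0] [Md d0]; split; first exact: MB.
  by move=> j ji; rewrite coordB c0 // d0 // subrr.
have Mi0 : Mi i 0 by split=> // j _; apply: coord0.
have MiS c : Mi i c -> coord i c = 0 -> Mi i.+1 c.
  move=> [Mc c0] ci; split=> // j; rewrite ltnS leq_eqVlt => /predU1P[->//|]; exact: c0.
have MSi c : Mi i.+1 c -> Mi i c.
  by move=> [Mc c0]; split=> // j ji; apply: c0; apply: ltnW.
have MiMz c n : Mi i c -> Mi i (c *~ n).
  move=> Mc; have s : zspan [:: c] (c *~ n).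
    by apply: (zspanMz (x := c)); apply: zspan_mem; rewrite inE.
  by apply: (s (Mi i) Mi0 MiB) => g; rewrite inE => /eqP->.
have [[c Mc ci]|none] := pselect (exists2 c, Mi i c & coord i c <> 0); last first.
  exists rs => c; rewrite rsP; split=> [|Mc]; first exact: MSi.
  by apply: MiS => //; apply: contrapT => ci; apply: none; exists c.
have ex : exists n, `[< exists2 c, Mi i c & absz (coord i c) = n.+1 >].
  exists (absz (coord i c)).-1; apply/asboolP; exists c => //; lia.
case: (ex_minnP ex) => n /asboolP[g Mg gn] minn.
exists (g :: rs) => {c Mc ci} c; split=> [sc|Mc].
  apply: (sc (Mi i) Mi0 MiB) => h.
  rewrite inE => /predU1P[->//|hr]; apply: MSi; apply/rsP.
  exact: zspan_mem.
pose q := (coord i c %/ coord i g)%Z; pose r := (coord i c %% coord i g)%Z.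
have coordMz h z : coord i (h *~ z) = coord i h * z.
  by rewrite (additive_funMz (coordB i)) mulrzz.
have cr : coord i (c - g *~ q) = r.
  rewrite coordB coordMz /r /q; have := divz_eq (coord i c) (coord i g); lia.
have Mr : Mi i (c - g *~ q) by apply: MiB => //; apply: MiMz.
have g0 : coord i g != 0 by lia.
have r0 : r = 0.
  have r_ge : 0 <= r by apply: modz_ge0.
  have r_lt : r < `|coord i g| by apply: ltz_mod.
  apply: contrapT => rn.
  have : (n <= (absz r).-1)%N.
    by apply: minn; apply/asboolP; exists (c - g *~ q) => //; rewrite cr; lia.
  by lia.
rewrite -[c](subrK (g *~ q)); apply: zspanD.
  have : zspan rs (c - g *~ q) by apply/rsP; apply: MiS => //; rewrite cr.
  by apply: sub_zspan => y yr; apply: zspan_mem; rewrite inE yr orbT.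
by apply: (zspanMz (x := g)); apply: zspan_mem; rewrite inE eqxx.
Qed.

Section Lift.
Variables (X : finType) (A : zmodType) (m : nat) (a : m.-tuple A).

Definition vec_of_tuple (t : m.-tuple int) : vec m := [ffun i => tnth t i].
Definition tuple_of_vec (v : vec m) : m.-tuple int := [tuple v i | i < m].

Definition vec_comb (v : vec m) : A := \sum_(i < m) tnth a i *~ v i.

Lemma vec_comb_tuple v : lincomb a (tuple_of_vec v) = vec_comb v.
Proof. by apply: eq_bigr => i _; rewrite tnth_mktuple. Qed.

Lemma lincomb_vec t : lincomb a t = vec_comb (vec_of_tuple t).
Proof. by apply: eq_bigr => i _; rewrite ffunE. Qed.

Lemma vec_combB c d : vec_comb (c - d) = vec_comb c - vec_comb d.
Proof.
by rewrite /vec_comb -sumrB; apply: eq_bigr => i _; rewrite !ffunE mulrzBr.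
Qed.

Lemma vec_comb0 : vec_comb 0 = 0.
Proof. exact: additive_fun0 vec_combB. Qed.

Lemma relations_fg : exists rs, forall c, zspan rs c <-> vec_comb c = 0.
Proof.
apply: subgroup_vec_fg; first exact: vec_comb0.
by move=> c d; rewrite vec_combB => -> ->; rewrite subrr.
Qed.

(** The relations rs of the generators of A are added as generators, so that the
subgroup of F x V is the full preimage of the subgroup of F x A. *)
Definition lift_input (rs : seq (vec m)) (S : seq (input_elt X m)) : seq (elt X m) :=
  [seq (x.1, vec_of_tuple x.2) | x <- S] ++ [seq ([::], r) | r <- rs].

Hypothesis Agen : generates a.
Variable rs : seq (vec m).
Hypothesis rsP : forall c, zspan rs c <-> vec_comb c = 0.

Lemma vec_comb_surj x : exists c, vec_comb c = x.
Proof. by have [t ->] := Agen x; exists (vec_of_tuple t); rewrite lincomb_vec. Qed.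

Lemma relation_span S d : vec_comb d = 0 -> span_elts (lift_input rs S) (1%g, d).
Proof.
have sL := generated_subgroup [set elt_val x | x in [set` lift_input rs S]].
move/rsP => sd; apply: (sd (fun d => span_elts (lift_input rs S) (1%g, d))).
- exact: sL.1.
- move=> y z sy sz; have := subgroup_pairM sL sy (subgroup_pairV sL sz).
  by rewrite invg1 mulg1.
- move=> r rr; apply: (span_elts_mem (x := ([::], r))); rewrite mem_cat.
  by apply/orP; right; apply: map_f.
Qed.

Lemma lift_inputP S w c :
  span_input a S (w, vec_comb c) <-> span_elts (lift_input rs S) (w, c).
Proof.
have sS := generated_subgroup [set denote a x | x in [set` S]].
have sL := generated_subgroup [set elt_val x | x in [set` lift_input rs S]].
split=> sw.
  pose P := [set g : FxA X A | forall c, vec_comb c = g.2 -> span_elts (lift_input rs S) (g.1, c)].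
  apply: (generated_min (H := P) _ _ sw) => //.
    split=> [d /= d0|x y Px Py d /= dxy]; first exact: relation_span.
    have [e ey] := vec_comb_surj y.2.
    have xe : vec_comb (d - (- e)) = x.2.
      rewrite vec_combB dxy -[- e]sub0r vec_combB vec_comb0 sub0r opprK ey.
      by change ((x.2 : A) - (y.2 : A) + (y.2 : A) = x.2); rewrite subrK.
    have := subgroup_pairM sL (Px _ xe) (subgroup_pairV sL (Py _ ey)).
    by rewrite opprK addrK.
  move=> _ [[u t] uS <-] d /= dt.
  have ut : span_elts (lift_input rs S) (fg_of_word u, vec_of_tuple t).
    apply: (span_elts_mem (x := (u, vec_of_tuple t))); rewrite mem_cat.
    by apply/orP; left; apply/mapP; exists (u, t).
  have /(@relation_span S) : vec_comb (d - vec_of_tuple t) = 0.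
    by rewrite vec_combB dt lincomb_vec subrr.
  by move=> /(subgroup_pairM sL ut); rewrite mulg1 addrC subrK.
pose P := [set g : FxA X (vec m) | span_input a S (g.1, vec_comb g.2)].
apply: (generated_min (H := P) _ _ sw) => //.
  split=> [|x y Px Py]; first by rewrite /P /= [vec_comb _]vec_comb0; exact: sS.1.
  have := subgroup_pairM sS Px (subgroup_pairV sS Py).
  by rewrite -vec_combB.
move=> _ [x + <-]; rewrite /= mem_cat => /orP[/mapP[y yS ->]|/mapP[r rr ->]].
  by apply: generated_mem; exists y => //; rewrite /denote lincomb_vec.
rewrite /P /=; have -> : vec_comb r = 0 by apply/rsP; apply: zspan_mem.
exact: sS.1.
Qed.

End Lift.

Section Describe.
Variables (X : finType) (m : nat).

#[export] Instance coded_aut_descr : coded (aut_descr X m) := @code_aut_descr X m.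

Lemma computable_code_value (C T : Type) (cC : coded C) (cT : coded T) (f : C -> T) :
  computable f -> computable (fun z => code (f z) : tree).
Proof. exact: (computable_code (g := f)). Qed.
#[local] Hint Resolve computable_code_value : computability.

Lemma computable_vec_of_tuple (C : Type) (cC : coded C) (t : C -> m.-tuple int) :
  computable t -> computable (fun z => vec_of_tuple (t z)).
Proof.
apply: computable_code => z; rewrite /code /coded_vec /coded_tuple; congr code_seq.
rewrite -[in RHS](map_tnth_enum (t z)); apply: eq_map => i; exact: ffunE.
Qed.

Lemma computable_tuple_of_vec (C : Type) (cC : coded C) (v : C -> vec m) :
  computable v -> computable (fun z => tuple_of_vec (v z)).
Proof. exact: (computable_code (g := v)). Qed.
#[local] Hint Resolve computable_vec_of_tuple computable_tuple_of_vec : computability.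

Definition words_upto k : seq (word X) :=
  iter k (fun L => [::] :: flatten [seq [seq l :: w | w <- L] | l <- letters X]) [:: [::]].

Lemma words_uptoP k w : (w \in words_upto k) = (size w <= k)%N.
Proof.
elim: k w => [|k IHk] [|l w] //=; rewrite inE //=.
apply/flatten_mapP/idP => [[l' _ /mapP[w' + [_ ->]]]|]; first by rewrite IHk.
by rewrite ltnS -IHk => wk; exists l; rewrite ?mem_enum //; apply: map_f.
Qed.

Definition splits (w : word X) : seq (word X * letter X) :=
  foldr (fun l L => ([::], l) :: [seq (l :: x.1, x.2) | x <- L]) [::] w.

Lemma splitsP w u l : reflect (exists v, w = u ++ l :: v) ((u, l) \in splits w).
Proof.
apply: (iffP idP).
  elim: w u l => [|l' w IHw] u l //=.
  rewrite inE => /predU1P[[-> ->]|/mapP[[u' l2] /IHw[v ->] [-> ->]]]; first by exists w.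
  by exists v.
move=> [v ->]; elim: u => [|l' u IHu]; first by rewrite inE eqxx.
by rewrite /= inE; apply/orP; right; apply/mapP; exists (u, l).
Qed.

Definition core_words (D : machine_pair X m) k : seq (word X) :=
  [seq w <- words_upto k | same_code (reduce w) w && isSome (completion D w)].

Lemma core_wordsP D k w : correct_pair D -> (w \in core_words D k) <->
  [/\ (size w <= k)%N, reduced_word w & proj (pair_meet D) w].
Proof.
move=> pairD; rewrite mem_filter words_uptoP same_codeE.
have red : (reduce w == w) = reduced_word w.
  by apply/eqP/idP => [<-|]; [exact: reduced_reduce | exact: reduce_id].
rewrite red; split=> [/andP[/andP[-> /(completionP _ pairD) ?] ->]|[-> -> /(completionP _ pairD) ->]] //.
Qed.

Definition describe_arc (D : machine_pair X m) (x : word X * letter X) : arc_descr X m :=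
  (code x.1 : tree,
   (tuple_of_vec (label1 D x.1 x.2), x.2, tuple_of_vec (label2 D x.1 x.2)),
   code (coset_rep D (rcons x.1 x.2)) : tree).

Definition describe (D : machine_pair X m) k : aut_descr X m :=
  @AutDescr X m (code ([::] : word X))
    (flatten [seq [seq code (coset_rep D u) : tree | u <- prefixes w] | w <- core_words D k])
    (flatten [seq [seq describe_arc D (coset_rep D x.1, x.2) | x <- splits w] | w <- core_words D k]).

Lemma computable_same_coset (C : Type) (cC : coded C) (D : C -> machine_pair X m) (u v : C -> word X) :
  computable D -> computable u -> computable v ->
  computable (fun z => same_coset (D z) (u z) (v z)).
Proof. by move=> cD cu cv; rewrite /same_coset /isSome; computability. Qed.
#[local] Hint Resolve computable_same_coset : computability.

Lemma computable_coset_rep (C : Type) (cC : coded C) (D : C -> machine_pair X m) (u : C -> word X) :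
  computable D -> computable u -> computable (fun z => coset_rep (D z) (u z)).
Proof. by move=> cD cu; rewrite /coset_rep; computability. Qed.
#[local] Hint Resolve computable_coset_rep : computability.

Lemma computable_arc_label (C : Type) (cC : coded C) (D : C -> machine_pair X m)
    (p : C -> word X) (l : C -> letter X) :
  computable D -> computable p -> computable l ->
  computable (fun z => arc_label (D z) (p z) (l z)).
Proof. by move=> cD cp cl; rewrite /arc_label /odflt /oapp; computability. Qed.
#[local] Hint Resolve computable_arc_label : computability.

Lemma computable_describe_arc (C : Type) (cC : coded C) (D : C -> machine_pair X m)
    (x : C -> word X * letter X) :
  computable D -> computable x -> computable (fun z => describe_arc (D z) (x z)).
Proof.
by move=> cD cx; rewrite /describe_arc /label1 /label2 /positive; computability.
Qed.
#[local] Hint Resolve computable_describe_arc : computability.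

Lemma computable_core_words (C : Type) (cC : coded C) (D : C -> machine_pair X m) (k : C -> nat) :
  computable D -> computable k -> computable (fun z => core_words (D z) (k z)).
Proof. by move=> cD ck; rewrite /core_words /words_upto /isSome; computability. Qed.
#[local] Hint Resolve computable_core_words : computability.

Lemma computable_splits (C : Type) (cC : coded C) (w : C -> word X) :
  computable w -> computable (fun z => splits (w z)).
Proof. by move=> cw; rewrite /splits; computability. Qed.
#[local] Hint Resolve computable_splits : computability.

Lemma computable_describe (C : Type) (cC : coded C) (D : C -> machine_pair X m) (k : C -> nat) :
  computable D -> computable k -> computable (fun z => describe (D z) (k z)).
Proof.
move=> cD ck.
apply: (@computable_code _ _ _ _ _ _ _ (fun z => (descr_base (describe (D z) (k z)),
   (descr_vertices (describe (D z) (k z)), descr_arcs (describe (D z) (k z)))))) => //.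
rewrite /describe /=; computability.
Qed.

Lemma computable_lift_input (C : Type) (cC : coded C) rs (S : C -> seq (input_elt X m)) :
  computable S -> computable (fun z => lift_input rs (S z)).
Proof. by move=> cS; rewrite /lift_input; computability. Qed.
#[local] Hint Resolve computable_lift_input : computability.

Lemma computable_basis : computable (fun D : machine_pair X m => map (@tuple_of_vec m) (abelian_meet D)).
Proof.
have c := @computable_abelian_meet X m; computability.
Qed.

Lemma finite_val_seq (T : choiceType) (P : pred T) (s : seq T) :
  finite_set [set x : {x | P x} | val x \in s].
Proof.
apply: (finite_preimage (f := val : {x | P x} -> T) (B := [set` s])).
  by move=> x y _ _; apply: val_inj.
exact: finite_seq.
Qed.

End Describe.

Local Close Scope ring_scope.
(** * The stages exhaust the automaton *)

Section Construction.
Variables (X : finType) (A : zmodType) (m : nat) (a : m.-tuple A) (D : machine_pair X m).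
Hypothesis pairD : correct_pair D.

Definition intersection_graph : enriched X A := stallings_graph (vec_combB a) pairD.
Local Notation G := intersection_graph.

Definition vertex_name (p : vertex G) : tree := code (val p : word X).
Definition stage_vertices k : set (vertex G) := [set p | core_vertex D k (val p)].
Definition stage_arcs k : set (Defs.arc G) := [set e | core_arc D k (val e).1 (val e).2].

Lemma vertex_name_inj : injective vertex_name.
Proof. by move=> p q /(@code_inj (word X)) /val_inj. Qed.

Lemma is_vertex_rep k u1 u2 : u1 ++ u2 \in core_words D k ->
  is_vertex D (coset_rep D u1) /\ core_vertex D k (coset_rep D u1).
Proof.
move=> /(core_wordsP _ _ pairD)[s r pr].
have c : core_vertex D k (coset_rep D u1) by exists u1, u2; split=> //; apply: coset_rep_eq.
by split=> //; apply/asboolP; split; [apply: coset_repK | exists k].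
Qed.

Lemma core_vertex_rep k (p : vertex G) : core_vertex D k (val p) ->
  exists u1 u2, u1 ++ u2 \in core_words D k /\ val p = coset_rep D u1.
Proof.
move=> [u1 [u2 [s r pr c]]]; exists u1, u2; split; first exact/(core_wordsP _ _ pairD).
by have /asboolP[rvp _] := valP p; apply: coset_rep_unique.
Qed.

Lemma is_arc_rep k u1 l u2 : u1 ++ l :: u2 \in core_words D k ->
  is_arc D (coset_rep D u1, l) /\ core_arc D k (coset_rep D u1) l.
Proof.
move=> /(core_wordsP _ _ pairD)[s r pr].
have c : core_arc D k (coset_rep D u1) l by exists u1, u2; split=> //; apply: coset_rep_eq.
by split=> //; apply/asboolP; split; [apply: coset_repK | exists k].
Qed.

Lemma core_arc_rep k (e : Defs.arc G) : core_arc D k (val e).1 (val e).2 ->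
  exists u1 u2, u1 ++ (val e).2 :: u2 \in core_words D k /\ (val e).1 = coset_rep D u1.
Proof.
move=> [u1 [u2 [s r pr c]]]; exists u1, u2; split; first exact/(core_wordsP _ _ pairD).
by have /asboolP[rve _] := valP e; apply: coset_rep_unique.
Qed.

Lemma stage_subautomaton k : subautomaton (stage_vertices k) (stage_arcs k).
Proof.
split=> [|e ce|e ce]; first exact: core_vertex_nil.
  by split; [exact: core_arc_source ce | exact: core_arc_target].
exact: core_arc_inv.
Qed.

Lemma describe_arcP (e : Defs.arc G) :
  describes_arc a vertex_name (describe_arc D (val e)) e.
Proof.
by split=> //; rewrite vec_comb_tuple.
Qed.

Lemma describe_stage k :
  describes a vertex_name (describe D k) (stage_vertices k) (stage_arcs k).
Proof.
split=> //.
- apply/seteqP; split=> t /=.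
    move/flatten_mapP => [w wk /mapP[u /prefixesP[v wE] ->]].
    rewrite wE in wk; have [vu cu] := is_vertex_rep wk.
    by exists (exist _ (coset_rep D u) vu).
  move=> [p cp <-]; have [u1 [u2 [wk rv]]] := core_vertex_rep cp.
  apply/flatten_mapP; exists (u1 ++ u2) => //; apply/mapP; exists u1.
    by apply/prefixesP; exists u2.
  by rewrite /vertex_name rv.
- move=> e ce; exists (describe_arc D (val e)); last exact: describe_arcP.
  have [u1 [u2 [wk rv]]] := core_arc_rep ce.
  apply/flatten_mapP; exists (u1 ++ (val e).2 :: u2) => //.
  apply/mapP; exists (u1, (val e).2); first by apply/splitsP; exists u2.
  by rewrite /= -rv -surjective_pairing.
- move=> _ /flatten_mapP[w wk /mapP[[u l] /splitsP[v wE] ->]].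
  rewrite wE in wk; have [ae ce] := is_arc_rep wk.
  by exists (exist _ (coset_rep D u, l) ae); last exact: describe_arcP.
Qed.

Lemma base_group_generated : base_group G =
  generated ([set lincomb a c | c in [set` map (@tuple_of_vec m) (abelian_meet D)]]
    : set (texp A)).
Proof.
apply/seteqP; split=> [_ [c /(abelian_meetP _ pairD) sc <-]|].
  set R := generated _; have sR : is_subgroup R := generated_subgroup _.
  apply: (sc (fun c => R (vec_comb a c))).
  - by rewrite vec_comb0; exact: sR.1.
  - by move=> y z Ry Rz; rewrite vec_combB; exact: (sR.2 _ _ Ry Rz).
  - move=> g gm; apply: generated_mem; exists (tuple_of_vec g); last exact: vec_comb_tuple.
    exact: map_f.
apply: (generated_min (base_groupP G)).
move=> _ [_ /mapP[c cm ->] <-]; exists c; last by rewrite vec_comb_tuple.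
by apply/(abelian_meetP _ pairD); apply: zspan_mem.
Qed.

Lemma graph_constructed (PL PG : prog) input :
  runs PL input (code (map (@tuple_of_vec m) (abelian_meet D))) ->
  (forall k, runs PG (Node input (code_nat k)) (code_aut_descr (describe D k))) ->
  recursively_constructs a PL PG input G.
Proof.
move=> runL runG; split.
  by exists (map (@tuple_of_vec m) (abelian_meet D)); [exact: runL | exact: base_group_generated].
exists vertex_name, stage_vertices, stage_arcs; split; first exact: vertex_name_inj.
split.
- move=> k; split; [exact: stage_subautomaton | split].
    apply: (sub_finite_set (B := [set p : vertex G |
      val p \in flatten [seq [seq coset_rep D u | u <- prefixes w] | w <- core_words D k]])).
      move=> p /core_vertex_rep[u1 [u2 [wk rv]]]; apply/flatten_mapP.
      exists (u1 ++ u2) => //; apply/mapP; exists u1 => //.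
      by apply/prefixesP; exists u2.
    exact: finite_val_seq.
  apply: (sub_finite_set (B := [set e : Defs.arc G |
    val e \in flatten [seq [seq (coset_rep D x.1, x.2) | x <- splits w] | w <- core_words D k]])).
    move=> e /core_arc_rep[u1 [u2 [wk rv]]]; apply/flatten_mapP.
    exists (u1 ++ (val e).2 :: u2) => //; apply/mapP; exists (u1, (val e).2).
      by apply/splitsP; exists u2.
    by rewrite /= -rv -surjective_pairing.
  exact: finite_val_seq.
- move=> k; split; first by move=> p; apply: core_vertex_mono.
  by move=> e; apply: core_arc_mono.
- split=> [p|e]; first by have /asboolP[_ [k c]] := valP p; exists k.
  by have /asboolP[_ [k c]] := valP e; exists k.
- by move=> k; exists (describe D k); [exact: runG | exact: describe_stage].
Qed.

End Construction.

Theorem theorem4p26 (X : finType) (A : zmodType) (m : nat) (a : m.-tuple A)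
    (Agen : generates a) :
  exists PL PG : prog,
    forall S1 S2 : seq (input_elt X m),
    exists G : enriched X A,
      stallings G (span_input a S1 `&` span_input a S2) /\
      recursively_constructs a PL PG
        (Node (code_input S1) (code_input S2)) G.
Proof.
have [rs rsP] := relations_fg a.
have [f cf fP] := machine_search X m.
pose lift := @lift_input X m rs.
pose D (I : seq (input_elt X m) * seq (input_elt X m)) : machine_pair X m :=
  ((lift I.1, f (lift I.1)), (lift I.2, f (lift I.2))).
have clift : computable lift by apply: computable_lift_input computable_id.
have cD : computable D by rewrite /D; computability.
have [PL PLP] : computable (fun I => map (@tuple_of_vec m) (abelian_meet (D I))).
  exact: computable_comp (@computable_basis X m) cD.
have [PG PGP] : computable
    (fun p : (seq (input_elt X m) * seq (input_elt X m)) * nat => describe (D p.1) p.2).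
  have cD1 : computable (fun p : (seq (input_elt X m) * seq (input_elt X m)) * nat => D p.1).
    by computability.
  exact: (computable_describe cD1 (@computable_proj2 _ _ nat _)).
exists PL, PG => S1 S2.
have pairD : correct_pair (D (S1, S2)) by split; apply: fP.
exists (intersection_graph a pairD); split; last first.
  apply: graph_constructed; first exact: (PLP (S1, S2)).
  by move=> k; exact: (PGP ((S1, S2), k)).
suff -> : span_input a S1 `&` span_input a S2 =
    [set g | exists2 c, pair_meet (D (S1, S2)) (g.1, c) & g.2 = vec_comb a c].
  exact: stallings_graphP.
apply/seteqP; split=> -[g x] /=.
  have [c <-] := vec_comb_surj Agen x.
  by move=> [/(lift_inputP Agen rsP) k1 /(lift_inputP Agen rsP) k2]; exists c.
by move=> [c [k1 k2] ->]; split; apply/(lift_inputP Agen rsP).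
Qed.
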